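(* Let $\theta=(\theta_t)_{t\in\mathbb R}$ be a smooth family of $1$-forms on $\mathbb C$ with $\theta_{t+1}=\theta_t$, and let $\mathcal A$, $\mathcal M$ be the associated functionals defined in the context. Suppose that $(z,\eta)\in\mathcal L^\times\mathbb C\times\mathcal L\mathbb C$ is a critical point of $\mathcal A$. Then $(z,\eta)$ is a solution of $$z'=\frac1{4\|z\|^2}\,\eta,\qquad \eta'=\frac{\|\eta\|^2-8}{4\|z\|^4}\,z+\operatorname{grad}\mathcal M(z),$$ where the $L^2$-gradient of $\mathcal M$ is given, writing $\vartheta_t=a^1_t\,dx+a^2_t\,dy$ and $\mathbf a_t=(a^1_t,a^2_t)$, by $$\begin{aligned}(\operatorname{grad}\mathcal M|_z)_\tau=&-\frac{2z_\tau}{\|z\|^4}\int_0^1\Bigl(\int_0^\sigma|z_\rho|^2d\rho\Bigr)\langle\dot{\mathbf a}_{t_z(\sigma)}|_{z_\sigma},z'_\sigma\rangle_0\,d\sigma-\frac{|z_\tau|^2}{\|z\|^2}\dot{\mathbf a}_{t_z(\tau)}|_{z_\tau}\\&+\frac{2z_\tau}{\|z\|^2}\int_\tau^1\langle\dot{\mathbf a}_{t_z(\sigma)}|_{z_\sigma},z'_\sigma\rangle_0\,d\sigma-(\operatorname{rot}\mathbf a_{t_z(\tau)})|_{z_\tau}\,iz'_\tau\end{aligned}$$ for each time $\tau\in\mathbb S^1$ (represented by $\tau\in[0,1)$).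
   Context: Identify $\mathbb C\cong\mathbb R^2$, $\mathbb S^1=\mathbb R/\mathbb Z$; $\langle\cdot,\cdot\rangle_0$, $|\cdot|$ are Euclidean inner product and norm; $\|\cdot\|$, $\langle\cdot,\cdot\rangle$ the $L^2(\mathbb S^1,\mathbb R^2)$ norm and inner product; $z_\tau=z(\tau)$. $\mathcal L\mathbb C=C^\infty(\mathbb S^1,\mathbb C)$, $\mathcal L^\times\mathbb C=\mathcal L\mathbb C\setminus\{0\}$ (zero loop removed). Let $\varsigma(z)=z^2$, $\vartheta_t:=\varsigma^*\theta_t$; a dot denotes the derivative in the time parameter $t$; $\operatorname{rot}\mathbf a_t=\partial_xa^2_t-\partial_ya^1_t$. For $z\in\mathcal L^\times\mathbb C$ put $t_z(\tau)=\|z\|^{-2}\int_0^\tau|z(s)|^2ds$ and, for $\xi\in\mathcal L\mathbb C$, $\Theta_z\xi=\int_0^1\vartheta_{t_z(\tau)}|_{z_\tau}\xi_\tau\,d\tau$. Define $\mathcal M(z)=\Theta_zz'$ and $$\mathcal A(z,\eta)=\langle\eta,z'\rangle+\Theta_zz'-\frac{\|\eta\|^2}{8\|z\|^2}+\frac1{\|z\|^2}$$ on $\mathcal L^\times\mathbb C\times\mathcal L\mathbb C$. A critical point is a point where the differential vanishes on all tangent vectors $(\hat z,\hat\eta)\in\mathcal L\mathbb C\times\mathcal L\mathbb C$. The $L^2$-gradient of $\mathcal M$ at $z$ is the function determined by $d\mathcal M|_z\xi=\int_0^1\langle(\operatorname{grad}\mathcal M|_z)_\tau,\xi_\tau\rangle_0\,d\tau$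 for all $\xi\in\mathcal L\mathbb C$. *)

(* Defs.v *)
From Stdlib Require Export Reals.
From Coquelicot Require Export Coquelicot.

Open Scope R_scope.

(** * Planar vectors and loops *)

Definition dot (u v : C) : R := Re u * Re v + Im u * Im v.

Definition vderiv (f : R -> C) (s : R) : C :=
  (Derive (fun r => Re (f r)) s, Derive (fun r => Im (f r)) s).

(** Maps on the circle [R/Z] are 1-periodic maps on [R]. *)
Definition periodic (z : R -> C) : Prop := forall tau, z (tau + 1) = z tau.

Definition loop (z : R -> C) : Prop :=
  periodic z /\
  forall (n : nat) (tau : R),
    ex_derive_n (fun s => Re (z s)) n tau /\ ex_derive_n (fun s => Im (z s)) n tau.

Definition nonzero_loop (z : R -> C) : Prop :=
  loop z /\ exists tau, z tau <> RtoC 0.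

Definition L2inner (u v : R -> C) : R := RInt (fun tau => dot (u tau) (v tau)) 0 1.

Definition L2norm (u : R -> C) : R := sqrt (L2inner u u).

(** The curve [e |-> z + e xi] through [z] with velocity [xi]. *)
Definition shift (z xi : R -> C) (e : R) : R -> C :=
  fun tau => (z tau + RtoC e * xi tau)%C.

(** * Time-dependent functions and 1-forms on the plane *)

Definition d_t (f : R -> C -> R) (t : R) (w : C) : R := Derive (fun s => f s w) t.
Definition d_x (f : R -> C -> R) (t : R) (w : C) : R :=
  Derive (fun x => f t (x, Im w)) (Re w).
Definition d_y (f : R -> C -> R) (t : R) (w : C) : R :=
  Derive (fun y => f t (Re w, y)) (Im w).

(** [f] is of class C^k on [R * C = R^3]. *)
Fixpoint class_C (k : nat) (f : R -> C -> R) : Prop :=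
  match k with
  | O => forall t w, continuous (fun p : R * C => f (fst p) (snd p)) (t, w)
  | S k' =>
      (forall t w,
          ex_derive (fun s => f s w) t /\
          ex_derive (fun x => f t (x, Im w)) (Re w) /\
          ex_derive (fun y => f t (Re w, y)) (Im w)) /\
      class_C k' f /\ class_C k' (d_t f) /\ class_C k' (d_x f) /\ class_C k' (d_y f)
  end.

(** [theta t w xi] is the value of the 1-form [theta_t] at the point [w] on the
    tangent vector [xi]. *)
Definition smooth_form_family (theta : R -> C -> C -> R) : Prop :=
  (forall t w,
      is_linear (U := C_R_NormedModule) (V := R_NormedModule) (theta t w)) /\
  (forall xi k, class_C k (fun t w => theta t w xi)).

Definition pullback (f : C -> C) (theta : R -> C -> C -> R) : R -> C -> C -> R :=
  fun t w xi => theta t (f w) (vderiv (fun s => f (w + RtoC s * xi)%C) 0).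

Definition square (w : C) : C := (w * w)%C.

Definition vartheta (theta : R -> C -> C -> R) : R -> C -> C -> R :=
  pullback square theta.

(** Coefficients: [vartheta_t = a1 dx + a2 dy]. *)
Definition a1 (theta : R -> C -> C -> R) (t : R) (w : C) : R :=
  vartheta theta t w (RtoC 1).
Definition a2 (theta : R -> C -> C -> R) (t : R) (w : C) : R :=
  vartheta theta t w Ci.

Definition a_dot (theta : R -> C -> C -> R) (t : R) (w : C) : C :=
  (d_t (a1 theta) t w, d_t (a2 theta) t w).

Definition rot_a (theta : R -> C -> C -> R) (t : R) (w : C) : R :=
  d_x (a2 theta) t w - d_y (a1 theta) t w.

(** * The functionals *)

Definition time (z : R -> C) (tau : R) : R :=
  RInt (fun s => Cmod (z s) ^ 2) 0 tau / L2norm z ^ 2.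

Definition Theta (theta : R -> C -> C -> R) (z xi : R -> C) : R :=
  RInt (fun tau => vartheta theta (time z tau) (z tau) (xi tau)) 0 1.

Definition magnetic (theta : R -> C -> C -> R) (z : R -> C) : R :=
  Theta theta z (vderiv z).

Definition action (theta : R -> C -> C -> R) (z eta : R -> C) : R :=
  L2inner eta (vderiv z) + Theta theta z (vderiv z)
  - L2norm eta ^ 2 / (8 * L2norm z ^ 2) + 1 / L2norm z ^ 2.

Definition critical_point (F : (R -> C) -> (R -> C) -> R) (z eta : R -> C) : Prop :=
  forall zhat etahat, loop zhat -> loop etahat ->
    is_derive (fun e => F (shift z zhat e) (shift eta etahat e)) 0 0.

(** As an L^2-class the gradient is only determined almost everywhere.  It is
    normalised here to its representative which is continuous on [[0,1)]; a
    jump at the integers is allowed, because the functionals at hand depend on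
    the base point 0 of the circle. *)
Definition is_L2_gradient (F : (R -> C) -> R) (z g : R -> C) : Prop :=
  periodic g /\
  continuous_on (fun tau => 0 <= tau < 1) (g : R -> C_R_NormedModule) /\
  forall xi, loop xi ->
    ex_RInt (fun tau => dot (g tau) (xi tau)) 0 1 /\
    is_derive (fun e => F (shift z xi e)) 0 (L2inner g xi).

Definition grad_formula (theta : R -> C -> C -> R) (z : R -> C) (tau : R) : C :=
  let adot s := a_dot theta (time z s) (z s) in
  let I1 := RInt (fun sigma =>
                    RInt (fun rho => Cmod (z rho) ^ 2) 0 sigma *
                    dot (adot sigma) (vderiv z sigma)) 0 1 in
  let I2 := RInt (fun sigma => dot (adot sigma) (vderiv z sigma)) tau 1 in
  (- (RtoC (2 / L2norm z ^ 4 * I1)%R * z tau)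
   - RtoC (Cmod (z tau) ^ 2 / L2norm z ^ 2)%R * adot tau
   + RtoC (2 / L2norm z ^ 2 * I2)%R * z tau
   - RtoC (rot_a theta (time z tau) (z tau)) * (Ci * vderiv z tau))%C.

(* Main.v *)
Require Import Defs.
From Stdlib Require Import Lra Lia FunctionalExtensionality.

(* Writing [vartheta_t = a1 dx + a2 dy], differentiate [magnetic (z + e xi)] under the
   integral sign. The result differs from [<grad_formula, xi>] by the derivative of a
   function taking the same value at 0 and 1: the derivative of [xi] is integrated by parts
   (no boundary term, since [time z 1 = time z 0 + 1] and [theta] is 1-periodic in time), and
   the variation of the reparametrised time is integrated by parts against the primitive
   of [<adot, z'>]. Powers of [1 + cos (2 pi (s - m)) - cos (2 pi d)] are smooth loops
   concentrating near [m]; testing against them turns the weak identities, i.e. uniqueness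
   of the gradient and both Euler-Lagrange equations, into pointwise ones on [[0,1)], and
   the equations extend to all times by periodicity. *)

(** * Continuity, integration and the chain rule *)

(** The obstacle is that [time z] is nonlocal in the loop: a variation at one point changes the
    partial energy at all later points and also the normalising total energy. The quotient rule
    separates the two effects. The numerator gives the term with the integral from tau to 1, the
    denominator the term with the double integral. Exchanging integrals is avoided: all terms to be
    moved are collected in one explicit antiderivative, [boundary], so the computation reduces to a
    pointwise identity and a comparison at 0 and 1. Along [shift z xi e] the partial energies are
    quadratic polynomials in e, hence the integral defining [magnetic] is the only one to be
    differentiated with respect to a parameter. Trigonometric test functions are used because they
    are periodic from the start and their smoothness follows from closure under derivatives and
    products. Since the gradient may jump at integers, continuity at 0 is available only from the
    right; the peaks are therefore centred slightly to the right of the point being tested. *)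

Lemma continuous_Rplus {U : UniformSpace} (f g : U -> R) (q : U) :
  continuous f q -> continuous g q -> continuous (fun p => f p + g p) q.
Proof. exact (continuous_plus (V := R_NormedModule) f g q). Qed.

Lemma continuous_Rmult {U : UniformSpace} (f g : U -> R) (q : U) :
  continuous f q -> continuous g q -> continuous (fun p => f p * g p) q.
Proof. exact (continuous_mult (K := R_AbsRing) f g q). Qed.

Lemma continuous_Ropp {U : UniformSpace} (f : U -> R) (q : U) :
  continuous f q -> continuous (fun p => - f p) q.
Proof. exact (continuous_opp (V := R_NormedModule) f q). Qed.

Lemma continuous_Rminus {U : UniformSpace} (f g : U -> R) (q : U) :
  continuous f q -> continuous g q -> continuous (fun p => f p - g p) q.
Proof. exact (continuous_minus (V := R_NormedModule) f g q). Qed.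

Lemma continuous_Rinv_fun {U : UniformSpace} (f : U -> R) (q : U) :
  continuous f q -> f q <> 0 -> continuous (fun p => / f p) q.
Proof.
  intros Hf H0. apply (continuous_comp f Rinv q Hf). now apply continuous_Rinv.
Qed.

Lemma continuous_Rdiv {U : UniformSpace} (f g : U -> R) (q : U) :
  continuous f q -> continuous g q -> g q <> 0 -> continuous (fun p => f p / g p) q.
Proof.
  intros Hf Hg H0. apply continuous_Rmult; [easy|]. now apply continuous_Rinv_fun.
Qed.

Lemma continuous_pow {U : UniformSpace} (f : U -> R) (n : nat) (q : U) :
  continuous f q -> continuous (fun p => f p ^ n) q.
Proof.
  intros Hf. induction n as [|n IH]; simpl.
  - apply continuous_const.
  - now apply continuous_Rmult.
Qed.

Lemma continuous_pair {U V W : UniformSpace} (f : U -> V) (g : U -> W) (q : U) :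
  continuous f q -> continuous g q -> continuous (fun p => (f p, g p)) q.
Proof.
  intros Hf Hg. apply (continuous_comp_2 f g (fun v w => (v, w)) q Hf Hg).
  apply (continuous_ext (fun p : V * W => p)); [now intros []|].
  apply continuous_id.
Qed.

Lemma continuous_of_snd {U V : UniformSpace} (f : V -> R) (q : U * V) :
  continuous f (snd q) -> continuous (fun p : U * V => f (snd p)) q.
Proof.
  intros Hf. apply (continuous_comp snd f q); [|easy].
  destruct q. apply continuous_snd.
Qed.

(** Descends through arithmetic operations; what it leaves are the leaves of the expression and, for
    each quotient, the nonvanishing of the denominator. *)
Ltac cont :=
  lazymatch goal with
  | |- continuous (fun p => @?f p + @?g p) _ => apply (continuous_Rplus f g); cont
  | |- continuous (fun p => @?f p * @?g p) _ => apply (continuous_Rmult f g); cont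
  | |- continuous (fun p => - @?f p) _ => apply (continuous_Ropp f); cont
  | |- continuous (fun p => @?f p - @?g p) _ => apply (continuous_Rminus f g); cont
  | |- continuous (fun p => @?f p / @?g p) _ => apply (continuous_Rdiv f g); cont
  | |- continuous (fun p => @?f p ^ ?n) _ => apply (continuous_pow f n); cont
  | |- continuous _ _ => try apply continuous_const
  | _ => idtac
  end.

Lemma ex_RInt_cont (f : R -> R) (a b : R) :
  (forall s, continuous f s) -> ex_RInt f a b.
Proof.
  intros Hf. apply (ex_RInt_continuous (V := R_CompleteNormedModule)). auto.
Qed.

Lemma is_derive_RInt_upper (f : R -> R) (a s : R) :
  (forall r, continuous f r) -> is_derive (fun b => RInt f a b) s (f s).
Proof.
  intros Hf. apply (is_derive_RInt f (fun b => RInt f a b) a s); [|apply Hf].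
  apply filter_forall. intros b. apply (RInt_correct (V := R_CompleteNormedModule)).
  now apply ex_RInt_cont.
Qed.

Lemma is_derive_RInt_lower (f : R -> R) (b s : R) :
  (forall r, continuous f r) -> is_derive (fun a => RInt f a b) s (- f s).
Proof.
  intros Hf. apply (is_derive_RInt' f (fun a => RInt f a b) s b); [|apply Hf].
  apply filter_forall. intros a. apply (RInt_correct (V := R_CompleteNormedModule)).
  now apply ex_RInt_cont.
Qed.

Lemma is_derive_continuous (f : R -> R) (s l : R) : is_derive f s l -> continuous f s.
Proof. intros H. apply (ex_derive_continuous (V := R_NormedModule)). now exists l. Qed.

(** The asymmetry is deliberate: the first partial derivative exists everywhere and is continuous at
    the point, while the second is asked for at that point only. Hence the second slot may itself
    hold a composite function, and a chain rule in several variables follows by freeing one variable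
    at a time. *)
Lemma is_derive_diag (f f1 : R -> R -> R) (u : R -> R) (e du l : R) :
  (forall x y, is_derive (fun x' => f x' y) x (f1 x y)) ->
  continuous (fun p => f1 (fst p) (snd p)) (u e, e) ->
  is_derive u e du ->
  is_derive (fun y => f (u e) y) e l ->
  is_derive (fun r => f (u r) r) e (f1 (u e) e * du + l).
Proof.
  intros Hf Hc Hu Hl. apply is_derive_Reals.
  replace (f1 (u e) e * du + l) with (f1 (u e) e * du + l * 1) by ring.
  apply (derivable_pt_lim_comp_2d f u (fun r => r) e (f1 (u e) e) l du 1).
  - apply filterdiff_differentiable_pt_lim.
    apply (is_derive_filterdiff f (u e) e f1 l); try assumption.
    apply filter_forall. intros p. apply Hf.
  - now apply is_derive_Reals.
  - apply derivable_pt_lim_id.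
Qed.

(** * Functions of class C^0 and C^1 of time and a point of the plane *)

Lemma class_C0_continuous {U : UniformSpace} (f : R -> C -> R) (T X Y : U -> R) (q : U) :
  class_C 0 f -> continuous T q -> continuous X q -> continuous Y q ->
  continuous (fun p => f (T p) (X p, Y p)) q.
Proof.
  intros Hf HT HX HY.
  apply (continuous_comp (V := prod_UniformSpace R_UniformSpace C_UniformSpace)
           (fun p => (T p, (X p, Y p) : C)) (fun p => f (fst p) (snd p)) q).
  - apply continuous_pair; [easy|]. now apply (continuous_pair X Y).
  - apply Hf.
Qed.

Lemma class_C1_partials (f : R -> C -> R) :
  class_C 1 f ->
  (forall t x y, is_derive (fun s => f s (x, y)) t (d_t f t (x, y))) /\
  (forall t x y, is_derive (fun s => f t (s, y)) x (d_x f t (x, y))) /\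
  (forall t x y, is_derive (fun s => f t (x, s)) y (d_y f t (x, y))) /\
  class_C 0 f /\ class_C 0 (d_t f) /\ class_C 0 (d_x f) /\ class_C 0 (d_y f).
Proof.
  intros [Hex Hcl].
  split; [|split; [|split; [|exact Hcl]]]; intros t x y;
    apply Derive_correct, (Hex t (x, y)).
Qed.

Lemma class_C0_d_t (f : R -> C -> R) : class_C 1 f -> class_C 0 (d_t f).
Proof. intros Hf. now destruct (class_C1_partials f Hf) as (_ & _ & _ & _ & H & _). Qed.

Lemma class_C0_d_x (f : R -> C -> R) : class_C 1 f -> class_C 0 (d_x f).
Proof. intros Hf. now destruct (class_C1_partials f Hf) as (_ & _ & _ & _ & _ & H & _). Qed.

Lemma class_C0_d_y (f : R -> C -> R) : class_C 1 f -> class_C 0 (d_y f).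
Proof. intros Hf. now destruct (class_C1_partials f Hf) as (_ & _ & _ & _ & _ & _ & H). Qed.

Lemma class_C1_chain (f : R -> C -> R) (T X Y : R -> R) (e dT dX dY : R) :
  class_C 1 f -> is_derive T e dT -> is_derive X e dX -> is_derive Y e dY ->
  is_derive (fun r => f (T r) (X r, Y r)) e
    (d_t f (T e) (X e, Y e) * dT + d_x f (T e) (X e, Y e) * dX
     + d_y f (T e) (X e, Y e) * dY).
Proof.
  intros Hf HT HX HY.
  destruct (class_C1_partials f Hf) as (Pt & Px & Py & C0 & Ct & Cx & Cy).
  pose proof (is_derive_continuous _ _ _ HX) as KX.
  pose proof (is_derive_continuous _ _ _ HY) as KY.
  rewrite Rplus_assoc.
  apply (is_derive_diag (fun t r => f t (X r, Y r)) (fun t r => d_t f t (X r, Y r))).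
  - intros t r. apply Pt.
  - apply class_C0_continuous; [easy| | |].
    + apply continuous_fst.
    + now apply (continuous_of_snd X).
    + now apply (continuous_of_snd Y).
  - easy.
  - apply (is_derive_diag (fun x r => f (T e) (x, Y r)) (fun x r => d_x f (T e) (x, Y r))).
    + intros x r. apply Px.
    + apply class_C0_continuous; [easy| | |].
      * apply continuous_const.
      * apply continuous_fst.
      * now apply (continuous_of_snd Y).
    + easy.
    + rewrite Rmult_comm.
      apply (is_derive_comp (fun y => f (T e) (X e, y)) Y); [apply Py|easy].
Qed.

(** Allows the partial derivatives to be given by formulas: [class_C] speaks of [Derive], and
    continuity passes to it because it agrees with the formula everywhere. *)
Lemma class_C1_intro (f ft fx fy : R -> C -> R) :
  (forall t x y, is_derive (fun s => f s (x, y)) t (ft t (x, y))) ->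
  (forall t x y, is_derive (fun s => f t (s, y)) x (fx t (x, y))) ->
  (forall t x y, is_derive (fun s => f t (x, s)) y (fy t (x, y))) ->
  class_C 0 f -> class_C 0 ft -> class_C 0 fx -> class_C 0 fy -> class_C 1 f.
Proof.
  intros Ht Hx Hy C0 Ct Cx Cy.
  split; [|split; [exact C0|]].
  - intros t [x y]. simpl.
    repeat split; eexists; [apply Ht|apply Hx|apply Hy].
  - repeat split; intros t w.
    + apply (continuous_ext (fun p : R * C => ft (fst p) (snd p))); [|apply Ct].
      intros [s [x y]]. symmetry. apply is_derive_unique, Ht.
    + apply (continuous_ext (fun p : R * C => fx (fst p) (snd p))); [|apply Cx].
      intros [s [x y]]. symmetry. apply is_derive_unique, Hx.
    + apply (continuous_ext (fun p : R * C => fy (fst p) (snd p))); [|apply Cy].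
      intros [s [x y]]. symmetry. apply is_derive_unique, Hy.
Qed.

(** * Regularity of the coefficients of [vartheta] *)

Lemma class_C0_Re : class_C 0 (fun _ w => Re w).
Proof.
  intros t w. apply (continuous_of_snd (V := C_UniformSpace) Re).
  destruct w. apply (continuous_fst (U := R_UniformSpace) (V := R_UniformSpace)).
Qed.

Lemma class_C0_Im : class_C 0 (fun _ w => Im w).
Proof.
  intros t w. apply (continuous_of_snd (V := C_UniformSpace) Im).
  destruct w. apply (continuous_snd (U := R_UniformSpace) (V := R_UniformSpace)).
Qed.

Lemma class_C0_const (c : R) : class_C 0 (fun _ _ => c).
Proof. intros t w. apply continuous_const. Qed.

Lemma class_C0_plus (f g : R -> C -> R) :
  class_C 0 f -> class_C 0 g -> class_C 0 (fun t w => f t w + g t w).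
Proof. intros Hf Hg t w. now apply continuous_Rplus; [apply Hf|apply Hg]. Qed.

Lemma class_C0_mult (f g : R -> C -> R) :
  class_C 0 f -> class_C 0 g -> class_C 0 (fun t w => f t w * g t w).
Proof. intros Hf Hg t w. now apply continuous_Rmult; [apply Hf|apply Hg]. Qed.

Lemma class_C1_const (c : R) : class_C 1 (fun _ _ => c).
Proof.
  apply (class_C1_intro _ (fun _ _ => 0) (fun _ _ => 0) (fun _ _ => 0));
    try apply class_C0_const; intros; apply (is_derive_const (V := R_NormedModule)).
Qed.

Lemma class_C1_Re : class_C 1 (fun _ w => Re w).
Proof.
  apply (class_C1_intro _ (fun _ _ => 0) (fun _ _ => 1) (fun _ _ => 0));
    try apply class_C0_const; try apply class_C0_Re; intros; simpl; auto_derive; easy.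
Qed.

Lemma class_C1_Im : class_C 1 (fun _ w => Im w).
Proof.
  apply (class_C1_intro _ (fun _ _ => 0) (fun _ _ => 0) (fun _ _ => 1));
    try apply class_C0_const; try apply class_C0_Im; intros; simpl; auto_derive; easy.
Qed.

Lemma class_C1_plus (f g : R -> C -> R) :
  class_C 1 f -> class_C 1 g -> class_C 1 (fun t w => f t w + g t w).
Proof.
  intros Hf Hg.
  destruct (class_C1_partials f Hf) as (ft & fx & fy & Cf & Cft & Cfx & Cfy).
  destruct (class_C1_partials g Hg) as (gt & gx & gy & Cg & Cgt & Cgx & Cgy).
  apply (class_C1_intro _ (fun t w => d_t f t w + d_t g t w)
           (fun t w => d_x f t w + d_x g t w) (fun t w => d_y f t w + d_y g t w));
    try (now apply class_C0_plus);
    intros; now apply (is_derive_plus (V := R_NormedModule)).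
Qed.

Lemma is_derive_Rmult (f g : R -> R) (s df dg : R) :
  is_derive f s df -> is_derive g s dg ->
  is_derive (fun r => f r * g r) s (df * g s + f s * dg).
Proof.
  intros Hf Hg. apply (is_derive_mult f g s df dg Hf Hg). apply Rmult_comm.
Qed.

Lemma class_C1_mult (f g : R -> C -> R) :
  class_C 1 f -> class_C 1 g -> class_C 1 (fun t w => f t w * g t w).
Proof.
  intros Hf Hg.
  destruct (class_C1_partials f Hf) as (ft & fx & fy & Cf & Cft & Cfx & Cfy).
  destruct (class_C1_partials g Hg) as (gt & gx & gy & Cg & Cgt & Cgx & Cgy).
  apply (class_C1_intro _ (fun t w => d_t f t w * g t w + f t w * d_t g t w)
           (fun t w => d_x f t w * g t w + f t w * d_x g t w)
           (fun t w => d_y f t w * g t w + f t w * d_y g t w));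
    try (apply class_C0_plus); try (now apply class_C0_mult);
    intros; now apply is_derive_Rmult.
Qed.

Lemma class_C0_comp (f X Y : R -> C -> R) :
  class_C 0 f -> class_C 0 X -> class_C 0 Y ->
  class_C 0 (fun t w => f t (X t w, Y t w)).
Proof.
  intros Hf HX HY t w. apply class_C0_continuous; [easy| |apply HX|apply HY].
  apply (continuous_fst (U := R_UniformSpace) (V := C_UniformSpace)).
Qed.

Lemma class_C1_comp (f X Y : R -> C -> R) :
  class_C 1 f -> class_C 1 X -> class_C 1 Y ->
  class_C 1 (fun t w => f t (X t w, Y t w)).
Proof.
  intros Hf HX HY.
  destruct (class_C1_partials f Hf) as (ft & fx & fy & Cf & Cft & Cfx & Cfy).
  destruct (class_C1_partials X HX) as (Xt & Xx & Xy & CX & CXt & CXx & CXy).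
  destruct (class_C1_partials Y HY) as (Yt & Yx & Yy & CY & CYt & CYx & CYy).
  pose (at_XY := fun (g : R -> C -> R) t w => g t (X t w, Y t w)).
  (* The common shape of the three partial derivatives by the chain rule; [c] is the derivative of
     the time slot, 1 in the direction of t and 0 in the directions of x and y. *)
  pose (pd := fun (c : R) (dX dY : R -> C -> R) t w =>
    at_XY (d_t f) t w * c + at_XY (d_x f) t w * dX t w + at_XY (d_y f) t w * dY t w).
  assert (Hpd : forall c dX dY, class_C 0 dX -> class_C 0 dY -> class_C 0 (pd c dX dY)).
  { intros c dX dY KX KY.
    repeat apply class_C0_plus; apply class_C0_mult; try easy;
      first [now apply class_C0_comp | apply class_C0_const]. }
  apply (class_C1_intro _ (pd 1 (d_t X) (d_t Y)) (pd 0 (d_x X) (d_x Y))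
           (pd 0 (d_y X) (d_y Y)));
    try (now apply Hpd); try (now apply class_C0_comp); intros t x y.
  - apply (class_C1_chain f (fun s => s) (fun s => X s (x, y)) (fun s => Y s (x, y)));
      auto. apply (is_derive_id (K := R_AbsRing)).
  - apply (class_C1_chain f (fun s => t) (fun s => X t (s, y)) (fun s => Y t (s, y)));
      auto. apply (is_derive_const (V := R_NormedModule)).
  - apply (class_C1_chain f (fun s => t) (fun s => X t (x, s)) (fun s => Y t (x, s)));
      auto. apply (is_derive_const (V := R_NormedModule)).
Qed.

Lemma vderiv_square_line (w xi : C) :
  vderiv (fun s => square (w + RtoC s * xi)%C) 0 = (RtoC 2 * w * xi)%C.
Proof.
  destruct w as [x y], xi as [p q]. unfold vderiv, square. apply injective_projections; simpl.
  - apply is_derive_unique. auto_derive; [easy|]. ring.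
  - apply is_derive_unique. auto_derive; [easy|]. ring.
Qed.

Ltac class_C1_tac :=
  lazymatch goal with
  | |- class_C 1 (fun t w => @?f t w + @?g t w) => apply (class_C1_plus f g); class_C1_tac
  | |- class_C 1 (fun t w => @?f t w * @?g t w) => apply (class_C1_mult f g); class_C1_tac
  | |- class_C 1 (fun t w => Re w) => exact class_C1_Re
  | |- class_C 1 (fun t w => Im w) => exact class_C1_Im
  | _ => try exact (class_C1_const _)
  end.

Section FormCoefficients.

Variable theta : R -> C -> C -> R.
Hypothesis theta_smooth : smooth_form_family theta.

Lemma theta_coords (t : R) (w xi : C) :
  theta t w xi = theta t w (RtoC 1) * Re xi + theta t w Ci * Im xi.
Proof.
  destruct theta_smooth as [Hlin _]. specialize (Hlin t w).
  destruct xi as [p q].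
  replace ((p, q) : C) with
    (@plus C_R_NormedModule (@scal _ C_R_NormedModule p (RtoC 1)) (@scal _ C_R_NormedModule q Ci)).
  - rewrite (linear_plus _ Hlin), !(linear_scal _ Hlin).
    simpl. unfold plus, scal, mult; simpl. unfold mult; simpl. ring.
  - apply injective_projections; cbn; unfold plus, scal, mult; simpl; unfold mult; simpl; ring.
Qed.

Lemma vartheta_eq (t : R) (w xi : C) :
  vartheta theta t w xi = theta t (square w) (RtoC 2 * w * xi)%C.
Proof. unfold vartheta, pullback. now rewrite vderiv_square_line. Qed.

Lemma vartheta_coords (t : R) (w xi : C) :
  vartheta theta t w xi = a1 theta t w * Re xi + a2 theta t w * Im xi.
Proof.
  unfold a1, a2. rewrite !vartheta_eq, !(theta_coords t (square w) (_ * _)%C).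
  destruct w as [x y], xi as [p q]. simpl. ring.
Qed.

Lemma class_C1_theta_square (xi : C) : class_C 1 (fun t w => theta t (square w) xi).
Proof.
  apply (class_C1_comp (fun t w => theta t w xi)
    (fun _ w => Re w * Re w - Im w * Im w) (fun _ w => Re w * Im w + Im w * Re w)).
  - apply theta_smooth.
  (* The real and imaginary parts here are those to which [square] reduces. The difference becomes a
     sum so that closure under sums and products suffices. *)
  - replace (fun (_ : R) w => Re w * Re w - Im w * Im w)
      with (fun (_ : R) w => Re w * Re w + (-1) * (Im w * Im w)).
    2: { apply functional_extensionality; intros _.
         apply functional_extensionality; intros w. ring. }
    class_C1_tac.
  - class_C1_tac.
Qed.

(** Squaring has differential multiplication by 2w, which sends 1 to (2x, 2y) and, in [class_C1_a2],
    i to (-2y, 2x). *)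
Lemma class_C1_a1 : class_C 1 (a1 theta).
Proof.
  replace (a1 theta) with (fun t w => theta t (square w) (RtoC 1) * (2 * Re w)
                                      + theta t (square w) Ci * (2 * Im w)).
  - class_C1_tac; apply class_C1_theta_square.
  - apply functional_extensionality; intros t.
    apply functional_extensionality; intros w. unfold a1.
    rewrite vartheta_eq, (theta_coords t _ (_ * _)%C). unfold Re, Im. simpl. ring.
Qed.

Lemma class_C1_a2 : class_C 1 (a2 theta).
Proof.
  replace (a2 theta) with (fun t w => theta t (square w) (RtoC 1) * (-2 * Im w)
                                      + theta t (square w) Ci * (2 * Re w)).
  - class_C1_tac; apply class_C1_theta_square.
  - apply functional_extensionality; intros t.
    apply functional_extensionality; intros w. unfold a2.
    rewrite vartheta_eq, (theta_coords t _ (_ * _)%C). unfold Re, Im. simpl. ring.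
Qed.

End FormCoefficients.

(** * Testing against smooth periodic functions *)

Definition smooth (f : R -> R) : Prop := forall n s, ex_derive_n f n s.

Definition real_loop (f : R -> R) : Prop := (forall s, f (s + 1) = f s) /\ smooth f.

(** [Derive_n] adds derivatives on the outside. Splitting off the innermost one instead lets an
    induction on the order use an explicit first derivative. *)
Lemma ex_derive_n_S (f : R -> R) (n : nat) (s : R) :
  ex_derive f s -> ex_derive_n (Derive f) n s -> ex_derive_n f (S n) s.
Proof.
  intros H0 Hn. destruct n as [|n]; [exact H0|].
  apply (ex_derive_ext (Derive_n (Derive f) n)); [|exact Hn].
  intros t. change (Derive f) with (Derive_n f 1). rewrite Derive_n_comp.
  f_equal. lia.
Qed.

Lemma smooth_Derive (f : R -> R) : smooth f -> smooth (Derive f).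
Proof.
  intros Hf [|n] s; [easy|].
  apply (ex_derive_ext (Derive_n f (S n))); [|exact (Hf (S (S n)) s)].
  intros t. change (Derive f) with (Derive_n f 1). rewrite Derive_n_comp.
  f_equal. lia.
Qed.

Lemma smooth_is_derive (f : R -> R) (s : R) : smooth f -> is_derive f s (Derive f s).
Proof. intros Hf. apply Derive_correct, (Hf 1%nat). Qed.

Lemma smooth_continuous (f : R -> R) (s : R) : smooth f -> continuous f s.
Proof. intros Hf. apply (is_derive_continuous f s (Derive f s)), smooth_is_derive, Hf. Qed.

Lemma smooth_mult (f g : R -> R) : smooth f -> smooth g -> smooth (fun s => f s * g s).
Proof.
  intros Hf Hg n. revert f g Hf Hg.
  (* The induction must be uniform in the two factors, since it is applied to the pairs (f', g) and
     (f, g'), and must cover all lower orders, which the sum rule for iterated derivatives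
     demands. *)
  enough (H : forall k, (k <= n)%nat -> forall f g, smooth f -> smooth g ->
                forall s, ex_derive_n (fun r => f r * g r) k s) by (intros; now apply (H n)).
  induction n as [|n IH]; intros k Hk f g Hf Hg s.
  - now replace k with 0%nat by lia.
  - destruct k as [|k]; [easy|]. apply ex_derive_n_S.
    + eexists. apply is_derive_Rmult; now apply smooth_is_derive.
    + apply (ex_derive_n_ext (fun r => Derive f r * g r + f r * Derive g r)).
      * intros r. symmetry. apply is_derive_unique, is_derive_Rmult; now apply smooth_is_derive.
      * apply ex_derive_n_plus; apply filter_forall; intros r j Hj;
          apply IH; auto using smooth_Derive; lia.
Qed.

Lemma real_loop_const (c : R) : real_loop (fun _ => c).
Proof. split; [easy|]. intros n s. apply ex_derive_n_const. Qed.

Lemma real_loop_pow (f : R -> R) (n : nat) : real_loop f -> real_loop (fun s => f s ^ n).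
Proof.
  intros [Hp Hf]. split; [intros s; now rewrite Hp|].
  induction n as [|n IH]; [apply (real_loop_const 1)|].
  now apply (smooth_mult f (fun s => f s ^ n)).
Qed.

Lemma real_loop_cos (c m : R) : real_loop (fun s => c + cos (2 * PI * (s - m))).
Proof.
  split.
  - intros s. replace (2 * PI * (s + 1 - m)) with (2 * PI * (s - m) + 2 * PI) by ring.
    rewrite cos_plus, cos_2PI, sin_2PI. ring.
  (* The family k + a cos + b sin is closed under differentiation, so the induction only changes
     coefficients. *)
  - enough (H : forall n k a b, smooth (fun _ => k) -> forall s, ex_derive_n
      (fun r => k + a * cos (2 * PI * (r - m)) + b * sin (2 * PI * (r - m))) n s).
    { intros n s. apply (ex_derive_n_ext
        (fun r => c + 1 * cos (2 * PI * (r - m)) + 0 * sin (2 * PI * (r - m)))).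
      - intros r. ring.
      - apply H, real_loop_const. }
    induction n as [|n IH]; intros k a b Hk s; [easy|].
    apply ex_derive_n_S.
    + auto_derive. easy.
    + apply (ex_derive_n_ext (fun r => 0 + (2 * PI * b) * cos (2 * PI * (r - m))
                                       + (- (2 * PI * a)) * sin (2 * PI * (r - m)))).
      * intros r. symmetry. apply is_derive_unique. auto_derive; [easy|]. unfold Rminus. ring.
      * apply IH, real_loop_const.
Qed.

(* The powers of [1 + cos (2 pi (s - m)) - cos (2 pi d)] blow up on [|s - m| < d]
   and stay bounded by 1 on the rest of the period. *)
Lemma RInt_peak (g : R -> R) (c m d : R) :
  0 < c -> 0 < d -> 0 <= m - d -> m + d <= 1 ->
  (forall s, m - d < s < m + d -> c <= g s) ->
  ex_RInt g 0 1 ->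
  exists phi, real_loop phi /\
    (ex_RInt (fun s => g s * phi s) 0 1 -> 0 < RInt (fun s => g s * phi s) 0 1).
Proof.
  intros Hc Hd H0 H1 Hg Hex.
  destruct (ex_RInt_ub g 0 1 Hex) as [M0 HM0].
  set (M := Rmax M0 0).
  assert (HM : forall s, 0 <= s <= 1 -> Rabs (g s) <= M).
  { intros s Hs. apply Rle_trans with M0; [|apply Rmax_l]. apply HM0.
    rewrite Rmin_left, Rmax_right; lra. }
  assert (M_ge0 : 0 <= M) by apply Rmax_r.
  pose proof PI_RGT_0 as HPI.
  assert (Hdd : d <= 1 / 2) by lra.
  set (p := fun s => 1 - cos (2 * PI * d) + cos (2 * PI * (s - m))).
  assert (Hcosabs : forall s, cos (2 * PI * (s - m)) = cos (2 * PI * Rabs (s - m))).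
  { intros s. unfold Rabs. destruct (Rcase_abs (s - m)); [|easy].
    rewrite <- cos_neg. f_equal. ring. }
  assert (Hin : forall s, Rabs (s - m) <= d -> 1 <= p s).
  { intros s Hs. unfold p. rewrite Hcosabs.
    enough (cos (2 * PI * d) <= cos (2 * PI * Rabs (s - m))) by lra.
    pose proof (Rabs_pos (s - m)).
    apply cos_decr_1; try (apply Rmult_le_pos; lra); nra. }
  (* The value of [p] at distance d/2 from m. It exceeds 1, so on the inner half of the peak the
     powers grow at least like q^n. *)
  set (q := 1 - cos (2 * PI * d) + cos (2 * PI * (d / 2))).
  assert (Hq : 1 < q).
  { unfold q. enough (cos (2 * PI * d) < cos (2 * PI * (d / 2))) by lra.
    apply cos_decreasing_1; try (apply Rmult_le_pos; lra); nra. }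
  assert (Hmid : forall s, Rabs (s - m) <= d / 2 -> q <= p s).
  { intros s Hs. unfold p, q. rewrite Hcosabs.
    apply Rplus_le_compat_l. pose proof (Rabs_pos (s - m)).
    apply cos_decr_1; try (apply Rmult_le_pos; lra); nra. }
  assert (Hout : forall s, 0 <= s <= 1 -> d <= Rabs (s - m) -> -1 <= p s <= 1).
  { intros s Hs Hds.
    assert (cos (2 * PI * (s - m)) <= cos (2 * PI * d)).
    { rewrite Hcosabs. assert (Hle : Rabs (s - m) <= 1 - d).
      { unfold Rabs. destruct (Rcase_abs (s - m)); lra. }
      (* Beyond half a period the cosine increases again; there it is compared with its value at 1 -
         d, which equals the one at d. *)
      destruct (Rle_dec (Rabs (s - m)) (1 / 2)).
      - apply cos_decr_1; try (apply Rmult_le_pos; lra); nra.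
      - replace (cos (2 * PI * d)) with (cos (2 * PI * (1 - d))).
        + apply cos_incr_1; nra.
        + replace (2 * PI * (1 - d)) with (- (2 * PI * d) + 2 * PI) by ring.
          rewrite cos_plus, cos_2PI, sin_2PI, cos_neg. ring. }
    unfold p. pose proof (COS_bound (2 * PI * d)). pose proof (COS_bound (2 * PI * (s - m))).
    lra. }
  assert (Hpow : forall n s, -1 <= s <= 1 -> -1 <= s ^ n <= 1).
  { intros n s Hs. apply Rabs_le_between. rewrite <- RPow_abs.
    rewrite <- (pow1 n). apply pow_incr. split; [apply Rabs_pos|].
    now apply Rabs_le_between. }
  (* The inner interval has length d and contributes at least c d q^n; the rest has length 1 - d and
     loses at most M (1 - d). So c d q^n >= M + 1 is enough for positivity. *)
  destruct (Pow_x_infinity q) with (b := (M + 1) / (c * d)) as [n Hn].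
  { rewrite Rabs_pos_eq; lra. }
  specialize (Hn n (le_n n)).
  rewrite Rabs_pos_eq in Hn by (apply pow_le; lra).
  assert (Hcd : 0 < c * d) by nra.
  assert (Hbig : M + 1 <= c * d * q ^ n).
  { apply Rge_le in Hn. apply (Rmult_le_compat_l (c * d)) in Hn; [|lra].
    replace (c * d * ((M + 1) / (c * d))) with (M + 1) in Hn by (field; nra). lra. }
  (* Between d/2 and d both factors are positive, and farther out the power is bounded by 1 in
     absolute value, so -M is a lower bound on the whole interval. *)
  assert (Hlow : forall s, 0 <= s <= 1 -> - M <= g s * p s ^ n).
  { intros s Hs. destruct (Rlt_dec (Rabs (s - m)) d) as [Hlt|Hge].
    - assert (1 <= p s ^ n) by (apply pow_R1_Rle, Hin; lra).
      assert (c <= g s).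
      { apply Hg. apply Rabs_lt_between in Hlt. lra. }
      nra.
    - pose proof (Hpow n _ (Hout s Hs (Rnot_lt_le _ _ Hge))) as Hpn.
      pose proof (HM s Hs) as Hgs. apply Rabs_le_between in Hgs. nra. }
  exists (fun s => p s ^ n). split.
  { apply real_loop_pow. apply real_loop_cos. }
  intros Hphi. set (f := fun s => g s * p s ^ n) in *.
  assert (E1 : ex_RInt f 0 (m - d / 2)) by (apply (ex_RInt_Chasles_1 f 0 _ 1); [lra|easy]).
  assert (E2 : ex_RInt f (m - d / 2) 1) by (apply (ex_RInt_Chasles_2 f 0 _ 1); [lra|easy]).
  assert (E3 : ex_RInt f (m - d / 2) (m + d / 2))
    by (apply (ex_RInt_Chasles_1 f _ _ 1); [lra|easy]).
  assert (E4 : ex_RInt f (m + d / 2) 1) by (apply (ex_RInt_Chasles_2 f (m - d / 2) _ 1); [lra|easy]).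
  rewrite <- (RInt_Chasles f 0 (m - d / 2) 1 E1 E2).
  rewrite <- (RInt_Chasles f (m - d / 2) (m + d / 2) 1 E3 E4).
  assert (Hconst : forall k a b, a <= b -> ex_RInt f a b ->
    (forall s, a < s < b -> k <= f s) -> (b - a) * k <= RInt f a b).
  { intros k a b Hab Hf Hk. rewrite <- (RInt_const (V := R_CompleteNormedModule) a b k : _ = (b - a) * k).
    apply RInt_le; auto. apply ex_RInt_const. }
  assert (I1 : (m - d / 2 - 0) * (- M) <= RInt f 0 (m - d / 2)).
  { apply Hconst; [lra|easy|]. intros s Hs. apply Hlow. lra. }
  assert (I2 : (m + d / 2 - (m - d / 2)) * (c * q ^ n) <= RInt f (m - d / 2) (m + d / 2)).
  { apply Hconst; [lra|easy|]. intros s Hs. unfold f.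
    assert (q ^ n <= p s ^ n).
    { apply pow_incr. split; [lra|]. apply Hmid. apply Rabs_le_between. lra. }
    assert (0 <= q ^ n) by (apply pow_le; lra).
    apply Rmult_le_compat; try lra. apply Hg. lra. }
  assert (I3 : (1 - (m + d / 2)) * (- M) <= RInt f (m + d / 2) 1).
  { apply Hconst; [lra|easy|]. intros s Hs. apply Hlow. lra. }
  unfold plus; simpl. nra.
Qed.

Lemma continuous_continuous_on {U : UniformSpace} (D : R -> Prop) (f : R -> U) :
  (forall s, continuous f s) -> continuous_on D f.
Proof.
  intros Hf s _. eapply filterlim_filter_le_1; [|apply Hf]. apply filter_le_within.
Qed.

Definition unit_interval (s : R) : Prop := 0 <= s < 1.

Lemma orthogonal_loops_nonpos (g : R -> R) (s : R) :
  continuous_on unit_interval g ->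
  (forall phi, real_loop phi -> is_RInt (fun r => g r * phi r) 0 1 0) ->
  0 <= s < 1 -> g s <= 0.
Proof.
  intros Hg Hint Hs. apply Rnot_lt_le. intros Hpos.
  (* Continuity on the half-open interval does not control g near 1; integrability comes from
     testing against the constant loop 1. *)
  assert (Hex : ex_RInt g 0 1).
  { exists 0. apply (is_RInt_ext (fun r => g r * 1)).
    - intros r _. apply Rmult_1_r.
    - apply (Hint (fun _ => 1)), real_loop_const. }
  assert (H2 : 0 < g s / 2) by lra.
  destruct (Hg s Hs (ball (g s) (mkposreal _ H2)) (locally_ball _ _)) as [eps Heps].
  (* On (s, s + r) the function stays above g(s)/2. The peak at s + r/2 with half-width r/2 lies
     inside [0,1] even for s = 0, and needs continuity from the right only. *)
  set (r := Rmin eps (1 - s)).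
  assert (Hr : 0 < r <= 1 - s).
  { unfold r. pose proof (cond_pos eps). split; [apply Rmin_glb_lt; lra|apply Rmin_r]. }
  assert (Hre : r <= eps) by apply Rmin_l.
  destruct (RInt_peak g (g s / 2) (s + r / 2) (r / 2)) as (phi & Hphi & Hphi_pos);
    try easy; try lra.
  - intros t Ht. assert (B : ball (g s) (g s / 2) (g t)).
    { apply Heps; [|unfold unit_interval; lra]. apply Rabs_lt_between.
      unfold minus, plus, opp; simpl. lra. }
    apply Rabs_lt_between in B. unfold minus, plus, opp in B; simpl in B. lra.
  - rewrite (is_RInt_unique _ _ _ _ (Hint phi Hphi)) in Hphi_pos.
    apply (Rlt_irrefl 0), Hphi_pos. exists 0. now apply Hint.
Qed.

Lemma orthogonal_loops_zero (g : R -> R) (s : R) :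
  continuous_on unit_interval g ->
  (forall phi, real_loop phi -> is_RInt (fun r => g r * phi r) 0 1 0) ->
  0 <= s < 1 -> g s = 0.
Proof.
  intros Hg Hint Hs. apply Rle_antisym; [now apply orthogonal_loops_nonpos|].
  enough (- g s <= 0) by lra.
  apply (orthogonal_loops_nonpos (fun r => - g r)); [| |easy].
  - intros r Hr. eapply filterlim_comp; [now apply Hg|].
    apply (filterlim_opp (V := R_NormedModule)).
  - intros phi Hphi.
    pose proof (is_RInt_opp (V := R_NormedModule) _ 0 1 0 (Hint phi Hphi)) as H.
    change (opp 0) with (- 0) in H. rewrite Ropp_0 in H. revert H. apply is_RInt_ext.
    intros r _. unfold opp; simpl. ring.
Qed.

(** * Loops *)

Lemma periodic_IZR {A : Type} (f : R -> A) (k : Z) (s : R) :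
  (forall r, f (r + 1) = f r) -> f (s + IZR k) = f s.
Proof.
  intros Hf.
  assert (Hn : forall n r, f (r + INR n) = f r).
  { induction n as [|n IH]; intros r; [now rewrite Rplus_0_r|].
    rewrite S_INR, <- Rplus_assoc, Hf. apply IH. }
  destruct (Z.le_gt_cases 0 k) as [Hk|Hk].
  - rewrite <- (Znat.Z2Nat.id k Hk), <- INR_IZR_INZ. apply Hn.
  - rewrite <- (Hn (Z.to_nat (- k)) (s + IZR k)). f_equal.
    rewrite INR_IZR_INZ, Znat.Z2Nat.id, opp_IZR by lia. ring.
Qed.

Lemma periodic_frac_part {A : Type} (f : R -> A) (s : R) :
  (forall r, f (r + 1) = f r) -> f (frac_part s) = f s.
Proof.
  intros Hf. rewrite <- (periodic_IZR f (Int_part s) (frac_part s) Hf). f_equal.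
  rewrite Rplus_comm. symmetry. apply Rplus_Int_part_frac_part.
Qed.

Lemma frac_part_unit (s : R) : 0 <= frac_part s < 1.
Proof. pose proof (base_fp s). lra. Qed.

Lemma frac_part_id (s : R) : 0 <= s < 1 -> frac_part s = s.
Proof.
  intros Hs. symmetry. apply (Int_part_frac_part_spec s 0 s Hs). simpl. ring.
Qed.

Lemma frac_part_add1 (s : R) : frac_part (s + 1) = frac_part s.
Proof.
  symmetry. apply (Int_part_frac_part_spec (s + 1) (Int_part s + 1) (frac_part s)).
  - apply frac_part_unit.
  - rewrite plus_IZR. rewrite (Rplus_Int_part_frac_part s) at 1. ring.
Qed.

(** The Leibniz rule with a prescribed derivative [D]. The assumptions are local in e because the
    reparametrised time of a shifted loop is controlled only while its norm is nonzero. *)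
Lemma is_derive_RInt_family (f D : R -> R -> R) (e0 : R) :
  locally e0 (fun e => forall s,
    is_derive (fun r => f r s) e (D e s) /\
    continuous (fun p : R * R => D (fst p) (snd p)) (e, s) /\
    continuous (f e) s) ->
  is_derive (fun e => RInt (f e) 0 1) e0 (RInt (D e0) 0 1).
Proof.
  intros H.
  rewrite (RInt_ext (D e0) (fun s => Derive (fun r => f r s) e0)).
  2: { intros s _. symmetry. apply is_derive_unique. now apply (locally_singleton _ _ H). }
  apply (is_derive_RInt_param f 0 1 e0).
  - apply (filter_imp _ _ ) with (2 := H). intros e He s _. exists (D e s). apply He.
  - intros s _.
    apply (continuity_2d_pt_ext_loc D).
    + destruct H as [eps Heps]. exists eps. intros u v Hu _. symmetry.
      apply is_derive_unique. apply (Heps u Hu).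
    + apply continuity_2d_pt_filterlim. now apply (locally_singleton _ _ H).
  - apply (filter_imp _ _) with (2 := H). intros e He. apply ex_RInt_cont. apply He.
Qed.

Lemma loop_Re_Im (z : R -> C) :
  loop z <-> real_loop (fun s => Re (z s)) /\ real_loop (fun s => Im (z s)).
Proof.
  split.
  - intros [Hp Hd]. split; split; try (intros s; now rewrite Hp); intros n s; apply Hd.
  - intros [[Hp1 Hd1] [Hp2 Hd2]]. split.
    + intros s. now apply injective_projections; [apply Hp1|apply Hp2].
    + intros n s. split; [apply Hd1|apply Hd2].
Qed.

Lemma loop_smooth (z : R -> C) :
  loop z -> smooth (fun s => Re (z s)) /\ smooth (fun s => Im (z s)).
Proof. intros Hz. apply loop_Re_Im in Hz. split; apply Hz. Qed.

(** Stated by coordinates so that the real-valued continuity lemmas apply directly;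
    [continuous_curve_continuous] translates to the normed module when the definition of the
    gradient requires it. *)
Definition continuous_curve (w : R -> C) : Prop :=
  forall s, continuous (fun r => Re (w r)) s /\ continuous (fun r => Im (w r)) s.

Lemma continuous_curve_loop (z : R -> C) : loop z -> continuous_curve z.
Proof.
  intros Hz s. apply loop_smooth in Hz.
  split; now apply smooth_continuous.
Qed.

Lemma continuous_curve_vderiv (z : R -> C) : loop z -> continuous_curve (vderiv z).
Proof.
  intros Hz s. apply loop_smooth in Hz.
  split; now apply smooth_continuous, smooth_Derive.
Qed.

Lemma continuous_dot (u v : R -> C) (s : R) :
  continuous_curve u -> continuous_curve v -> continuous (fun r => dot (u r) (v r)) s.
Proof. intros Hu Hv. unfold dot. cont; first [apply Hu | apply Hv]. Qed.

Lemma Cmod_sq (w : C) : Cmod w ^ 2 = dot w w.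
Proof. unfold Cmod, dot, Re, Im. rewrite pow2_sqrt; nra. Qed.

(** One object for three roles: the numerator of [time], the primitive used in integrating by parts,
    and, at s = 1, by mere unfolding, [L2inner]. *)
Definition partial_inner (u v : R -> C) (s : R) : R :=
  RInt (fun r => dot (u r) (v r)) 0 s.

Lemma is_derive_partial_inner (u v : R -> C) (s : R) :
  continuous_curve u -> continuous_curve v ->
  is_derive (partial_inner u v) s (dot (u s) (v s)).
Proof.
  intros Hu Hv. apply (is_derive_RInt_upper (fun r => dot (u r) (v r))).
  intros r. now apply continuous_dot.
Qed.

Lemma continuous_partial_inner (u v : R -> C) (s : R) :
  continuous_curve u -> continuous_curve v -> continuous (partial_inner u v) s.
Proof. intros Hu Hv. eapply is_derive_continuous. now apply is_derive_partial_inner. Qed.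

Lemma L2norm_sq (z : R -> C) : loop z -> L2norm z ^ 2 = partial_inner z z 1.
Proof.
  intros Hz. apply pow2_sqrt. apply RInt_ge_0; [lra| |].
  - apply ex_RInt_cont. intros s. apply continuous_dot; now apply continuous_curve_loop.
  - intros s _. unfold dot. nra.
Qed.

Lemma partial_inner_pos (z : R -> C) : nonzero_loop z -> 0 < partial_inner z z 1.
Proof.
  intros [Hz [tau Htau]].
  pose proof (continuous_curve_loop z Hz) as Hc.
  set (f := fun s => dot (z s) (z s)).
  assert (Hf : forall s, continuous f s) by (intros s; now apply continuous_dot).
  assert (Hf0 : forall s, 0 <= f s) by (intros s; unfold f, dot; nra).
  destruct (Rle_lt_dec (partial_inner z z 1) 0) as [Hle|]; [exfalso|easy].
  assert (Hint : RInt f 0 1 = 0).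
  { apply Rle_antisym; [exact Hle|]. apply RInt_ge_0; [lra|now apply ex_RInt_cont|auto]. }
  assert (Hzero : f (frac_part tau) = 0).
  { apply orthogonal_loops_zero; [| |apply frac_part_unit].
    - now apply continuous_continuous_on.
    (* If the nonnegative f has integral 0 and |phi| <= M, then the integral of f phi is squeezed
       between those of -M f and M f, both 0. Thus f is orthogonal to all loops and the uniqueness
       lemma applies to it. *)
    - intros phi [_ Hphi].
      assert (Kphi : forall s, continuous phi s) by (intros s; now apply smooth_continuous).
      assert (K : forall s, continuous (fun r => f r * phi r) s)
        by (intros s; now apply continuous_Rmult).
      destruct (ex_RInt_ub phi 0 1 (ex_RInt_cont _ _ _ Kphi)) as [M HM].
      assert (Hb : forall k, RInt (fun s => k * f s) 0 1 = 0).
      { intros k. transitivity (k * RInt f 0 1); [|rewrite Hint; apply Rmult_0_r].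
        apply (RInt_scal (V := R_CompleteNormedModule) f). now apply ex_RInt_cont. }
      assert (Kb : forall k, ex_RInt (fun s => k * f s) 0 1).
      { intros k. apply ex_RInt_cont. intros s. apply continuous_Rmult; [|easy].
        apply continuous_const. }
      replace 0 with (RInt (fun r => f r * phi r) 0 1) at 2.
      { apply (RInt_correct (V := R_CompleteNormedModule)). now apply ex_RInt_cont. }
      assert (HMs : forall s, 0 < s < 1 -> - M <= phi s <= M).
      { intros s Hs. apply Rabs_le_between. apply HM. rewrite Rmin_left, Rmax_right; lra. }
      apply Rle_antisym.
      + apply Rle_trans with (RInt (fun s => M * f s) 0 1); [|apply Req_le, Hb]. apply RInt_le; auto using ex_RInt_cont; [lra|].
        intros s Hs. specialize (HMs s Hs). specialize (Hf0 s). nra.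
      + apply Rle_trans with (RInt (fun s => - M * f s) 0 1);
          [apply Req_le; symmetry; apply Hb|]. apply RInt_le; auto using ex_RInt_cont; [lra|].
        intros s Hs. specialize (HMs s Hs). specialize (Hf0 s). nra. }
  apply Htau. destruct Hz as [Hp _]. rewrite <- (periodic_frac_part z tau Hp).
  unfold f, dot in Hzero.
  apply injective_projections; simpl; unfold Re, Im in Hzero; nra.
Qed.

Lemma time_eq (z : R -> C) (s : R) :
  loop z -> time z s = partial_inner z z s / partial_inner z z 1.
Proof.
  intros Hz. unfold time. rewrite (L2norm_sq z Hz).
  replace (fun s => Cmod (z s) ^ 2) with (fun s => dot (z s) (z s)); [easy|].
  apply functional_extensionality. intros r. now rewrite Cmod_sq.
Qed.

Lemma RInt_lin3 (f g h : R -> R) (k l s : R) :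
  (forall r, continuous f r) -> (forall r, continuous g r) -> (forall r, continuous h r) ->
  RInt (fun r => f r + k * g r + l * h r) 0 s
  = RInt f 0 s + k * RInt g 0 s + l * RInt h 0 s.
Proof.
  intros Hf Hg Hh. apply is_RInt_unique.
  pose proof (fun u Hu => RInt_correct (V := R_CompleteNormedModule) u 0 s (ex_RInt_cont u 0 s Hu))
    as H.
  apply (is_RInt_plus (V := R_NormedModule) (fun r => f r + k * g r) (fun r => l * h r)).
  - apply (is_RInt_plus (V := R_NormedModule) f (fun r => k * g r)); [now apply H|].
    apply (is_RInt_scal (V := R_NormedModule) g). now apply H.
  - apply (is_RInt_scal (V := R_NormedModule) h). now apply H.
Qed.

(** Makes the e-dependence of norm and time polynomial, so that their derivatives are purely
    algebraic. *)
Lemma partial_inner_shift (z xi : R -> C) (e s : R) :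
  continuous_curve z -> continuous_curve xi ->
  partial_inner (shift z xi e) (shift z xi e) s
  = partial_inner z z s + (2 * e) * partial_inner z xi s + e ^ 2 * partial_inner xi xi s.
Proof.
  intros Hz Hxi. unfold partial_inner.
  rewrite <- RInt_lin3 by (intros; now apply continuous_dot).
  apply RInt_ext. intros r _. unfold dot, shift, Re, Im. simpl. ring.
Qed.

Lemma loop_shift (z xi : R -> C) (e : R) : loop z -> loop xi -> loop (shift z xi e).
Proof.
  intros [Hz Dz] [Hxi Dxi]. split.
  - intros s. unfold shift. now rewrite Hz, Hxi.
  - intros n s. split.
    + apply (ex_derive_n_ext (fun r => Re (z r) + e * Re (xi r))).
      { intros r. unfold shift, Re. simpl. ring. }
      apply ex_derive_n_plus; apply filter_forall; intros r k _; [apply Dz|].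
      apply ex_derive_n_scal_l, Dxi.
    + apply (ex_derive_n_ext (fun r => Im (z r) + e * Im (xi r))).
      { intros r. unfold shift, Im. simpl. ring. }
      apply ex_derive_n_plus; apply filter_forall; intros r k _; [apply Dz|].
      apply ex_derive_n_scal_l, Dxi.
Qed.

Lemma vderiv_shift (z xi : R -> C) (e s : R) : loop z -> loop xi ->
  vderiv (shift z xi e) s = shift (vderiv z) (vderiv xi) e s.
Proof.
  intros Hz Hxi. apply loop_smooth in Hz. apply loop_smooth in Hxi.
  destruct Hz as [Hx Hy], Hxi as [Hp Hq].
  apply injective_projections; simpl.
  - apply is_derive_unique.
    apply (is_derive_ext (fun r => Re (z r) + e * Re (xi r))).
    { intros r. unfold shift, Re. simpl. ring. }
    rewrite Rmult_0_l, Rminus_0_r.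
    apply (is_derive_plus (V := R_NormedModule)); [now apply smooth_is_derive|].
    apply is_derive_scal. now apply smooth_is_derive.
  - apply is_derive_unique.
    apply (is_derive_ext (fun r => Im (z r) + e * Im (xi r))).
    { intros r. unfold shift, Im. simpl. ring. }
    rewrite Rmult_0_l, Rplus_0_r.
    apply (is_derive_plus (V := R_NormedModule)); [now apply smooth_is_derive|].
    apply is_derive_scal. now apply smooth_is_derive.
Qed.

(** * The gradient formula *)

Lemma dot_1 (w : C) : dot w (RtoC 1) = Re w.
Proof. unfold dot, Re, Im. simpl. ring. Qed.

Lemma dot_Ci (w : C) : dot w Ci = Im w.
Proof. unfold dot, Re, Im. simpl. ring. Qed.

Section Gradient.

Variable theta : R -> C -> C -> R.
Hypothesis theta_smooth : smooth_form_family theta.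
Variable z : R -> C.
Hypothesis z_nonzero : nonzero_loop z.

Let z_loop : loop z := proj1 z_nonzero.
Let z_cont : continuous_curve z := continuous_curve_loop z z_loop.
Let dz_cont : continuous_curve (vderiv z) := continuous_curve_vderiv z z_loop.
Let A : R := partial_inner z z 1.

Definition a_dot_along (s : R) : C := a_dot theta (time z s) (z s).
Definition a_dot_speed (s : R) : R := dot (a_dot_along s) (vderiv z s).
(** At s = 1 this is the double integral in the first term of the gradient; as a function of s it is
    the primitive needed in [boundary]. *)
Definition weighted_speed (s : R) : R :=
  RInt (fun r => partial_inner z z r * a_dot_speed r) 0 s.

Lemma is_derive_time (s : R) : is_derive (time z) s (dot (z s) (z s) / A).
Proof.
  apply (is_derive_ext (fun r => partial_inner z z r * / A)).
  { intros r. symmetry. now apply time_eq. }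
  apply (is_derive_scal_l (V := R_NormedModule) (partial_inner z z) s _ (/ A)).
  now apply is_derive_partial_inner.
Qed.

Lemma continuous_along (f : R -> C -> R) (s : R) :
  class_C 0 f -> continuous (fun r => f (time z r) (z r)) s.
Proof.
  intros Hf. apply (continuous_ext (fun r => f (time z r) (Re (z r), Im (z r)))).
  { intros r. unfold Re, Im. now rewrite <- surjective_pairing. }
  apply class_C0_continuous; [easy| |apply z_cont|apply z_cont].
  apply (is_derive_continuous _ _ _ (is_derive_time s)).
Qed.

Lemma is_derive_along (f : R -> C -> R) (s : R) :
  class_C 1 f ->
  is_derive (fun r => f (time z r) (z r)) s
    (d_t f (time z s) (z s) * (dot (z s) (z s) / A)
     + d_x f (time z s) (z s) * Re (vderiv z s) + d_y f (time z s) (z s) * Im (vderiv z s)).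
Proof.
  intros Hf.
  assert (E : forall r, z r = (Re (z r), Im (z r)))
    by (intros r; unfold Re, Im; apply surjective_pairing).
  apply (is_derive_ext (fun r => f (time z r) (Re (z r), Im (z r)))).
  { intros r. now rewrite <- E. }
  destruct (loop_smooth z z_loop) as [Hx Hy].
  pose proof (class_C1_chain f (time z) (fun r => Re (z r)) (fun r => Im (z r)) s
    _ _ _ Hf (is_derive_time s) (smooth_is_derive _ s Hx) (smooth_is_derive _ s Hy)) as H.
  cbv beta in H. now rewrite <- E in H.
Qed.

Lemma continuous_a_dot_along : continuous_curve a_dot_along.
Proof.
  intros s. split.
  - apply (continuous_along (d_t (a1 theta))), class_C0_d_t, class_C1_a1, theta_smooth.
  - apply (continuous_along (d_t (a2 theta))), class_C0_d_t, class_C1_a2, theta_smooth.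
Qed.

Lemma continuous_a_dot_speed (s : R) : continuous a_dot_speed s.
Proof. apply continuous_dot; [apply continuous_a_dot_along|apply dz_cont]. Qed.

Lemma is_derive_weighted_speed (s : R) :
  is_derive weighted_speed s (partial_inner z z s * a_dot_speed s).
Proof.
  apply (is_derive_RInt_upper (fun r => partial_inner z z r * a_dot_speed r)).
  intros r. apply continuous_Rmult; [now apply continuous_partial_inner|].
  apply continuous_a_dot_speed.
Qed.

(** Even powers of the norm become powers of [A], and pairing -i z' with w gives the determinant in
    the last term. Everything after this is real algebra. *)
Lemma dot_grad_formula (s : R) (w : C) :
  dot (grad_formula theta z s) w
  = - (2 / A ^ 2 * weighted_speed 1) * dot (z s) w
    - dot (z s) (z s) / A * dot (a_dot_along s) w
    + 2 / A * RInt a_dot_speed s 1 * dot (z s) w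
    + rot_a theta (time z s) (z s)
      * (Im (vderiv z s) * Re w - Re (vderiv z s) * Im w).
Proof.
  unfold grad_formula.
  replace (L2norm z ^ 4) with ((L2norm z ^ 2) ^ 2) by ring.
  rewrite (L2norm_sq z z_loop), Cmod_sq. fold A.
  replace (fun rho => Cmod (z rho) ^ 2) with (fun rho => dot (z rho) (z rho)).
  2: { apply functional_extensionality. intros r. now rewrite Cmod_sq. }
  change (RInt (fun sigma => RInt (fun rho => dot (z rho) (z rho)) 0 sigma *
            dot (a_dot theta (time z sigma) (z sigma)) (vderiv z sigma)) 0 1)
    with (weighted_speed 1).
  change (RInt (fun sigma => dot (a_dot theta (time z sigma) (z sigma)) (vderiv z sigma)) s 1)
    with (RInt a_dot_speed s 1).
  change (a_dot theta (time z s) (z s)) with (a_dot_along s).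
  generalize (dot (z s) (z s)) as q. intros q.
  unfold dot, Re, Im. simpl. ring.
Qed.

Lemma continuous_dot_grad_formula (w : R -> C) (s : R) :
  continuous_curve w -> continuous (fun r => dot (grad_formula theta z r) (w r)) s.
Proof.
  intros Hw.
  apply (continuous_ext (fun r =>
    - (2 / A ^ 2 * weighted_speed 1) * dot (z r) (w r)
    + - (dot (z r) (z r) / A * dot (a_dot_along r) (w r))
    + 2 / A * RInt a_dot_speed r 1 * dot (z r) (w r)
    + rot_a theta (time z r) (z r)
      * (Im (vderiv z r) * Re (w r) - Re (vderiv z r) * Im (w r)))).
  { intros r. symmetry. apply dot_grad_formula. }
  pose proof continuous_a_dot_along as Ka.
  assert (Krot : continuous (fun r => rot_a theta (time z r) (z r)) s).
  { apply (continuous_along (fun t v => d_x (a2 theta) t v - d_y (a1 theta) t v)).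
    intros t v. apply continuous_Rminus.
    - now apply (class_C0_d_x (a2 theta)), class_C1_a2.
    - now apply (class_C0_d_y (a1 theta)), class_C1_a1. }
  assert (KI : continuous (fun r => RInt a_dot_speed r 1) s).
  { eapply is_derive_continuous. apply is_derive_RInt_lower, continuous_a_dot_speed. }
  pose proof (fun u (Hu : continuous_curve u) => continuous_dot u w s Hu Hw) as Kw.
  pose proof (continuous_dot z z s z_cont z_cont) as Kzz.
  destruct (Hw s), (dz_cont s).
  assert (HA : A <> 0) by (pose proof (partial_inner_pos z z_nonzero); unfold A; lra).
  cont; auto using pow_nonzero.
Qed.

(** The formula makes sense and is continuous on the whole line; a jump can appear only once it is
    restricted to [0,1) and periodised. Pairing with 1 and i reads off its coordinates. *)
Lemma continuous_curve_grad_formula : continuous_curve (grad_formula theta z).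
Proof.
  intros s. split.
  - apply (continuous_ext (fun r => dot (grad_formula theta z r) (RtoC 1))).
    { intros r. apply dot_1. }
    apply (continuous_dot_grad_formula (fun _ => RtoC 1)).
    intros r. split; apply continuous_const.
  - apply (continuous_ext (fun r => dot (grad_formula theta z r) Ci)).
    { intros r. apply dot_Ci. }
    apply (continuous_dot_grad_formula (fun _ => Ci)).
    intros r. split; apply continuous_const.
Qed.

End Gradient.

(** * First variation of the magnetic functional *)

Section Variation.

Variable theta : R -> C -> C -> R.
Hypothesis theta_smooth : smooth_form_family theta.
Variables z xi : R -> C.
Hypothesis z_nonzero : nonzero_loop z.
Hypothesis xi_loop : loop xi.

Let z_loop : loop z := proj1 z_nonzero.
Let z_cont : continuous_curve z := continuous_curve_loop z z_loop.
Let xi_cont : continuous_curve xi := continuous_curve_loop xi xi_loop.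

(** The energy of the shifted loop on [0, s], already in polynomial form; [T] is then its
    reparametrised time and [dT] the derivative of [T] in e. *)
Let energy (e s : R) : R :=
  partial_inner z z s + (2 * e) * partial_inner z xi s + e ^ 2 * partial_inner xi xi s.
Let denergy (e s : R) : R := 2 * partial_inner z xi s + 2 * e * partial_inner xi xi s.
Let T (e s : R) : R := energy e s / energy e 1.
Let dT (e s : R) : R :=
  (denergy e s * energy e 1 - energy e s * denergy e 1) / energy e 1 ^ 2.
Let X (e s : R) : R := Re (z s) + e * Re (xi s).
Let Y (e s : R) : R := Im (z s) + e * Im (xi s).

(** The contribution of one coordinate to the integrand: [b] is a coefficient of the form, [v] and
    [w] are the matching coordinates of z' and xi'. *)
Let term (b : R -> C -> R) (v w : R -> R) (e s : R) : R :=
  b (T e s) (X e s, Y e s) * (v s + e * w s).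
Let dterm (b : R -> C -> R) (v w : R -> R) (e s : R) : R :=
  (d_t b (T e s) (X e s, Y e s) * dT e s + d_x b (T e s) (X e s, Y e s) * Re (xi s)
   + d_y b (T e s) (X e s, Y e s) * Im (xi s)) * (v s + e * w s)
  + b (T e s) (X e s, Y e s) * w s.

(** For some e the shifted loop may vanish identically, so denominators are under control only near
    0. *)
Lemma energy_pos_near : locally 0 (fun e => 0 < energy e 1).
Proof.
  assert (Hc : continuous (fun e => energy e 1) 0).
  { unfold energy. cont; apply continuous_id. }
  apply Hc. apply (open_gt 0). unfold energy. pose proof (partial_inner_pos z z_nonzero). nra.
Qed.

Ltac cont2 := cont;
  lazymatch goal with
  | |- continuous (fun p => ?f (snd p)) _ => apply (continuous_of_snd f)
  | |- continuous (fun p => Re (?f (snd p))) _ => apply (continuous_of_snd (fun s => Re (f s)))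
  | |- continuous (fun p => Im (?f (snd p))) _ => apply (continuous_of_snd (fun s => Im (f s)))
  | |- continuous (fun p => fst p) _ => apply continuous_fst
  | |- continuous fst _ => apply continuous_fst
  | _ => idtac
  end; auto using continuous_partial_inner; try apply z_cont; try apply xi_cont.

(** The three conclusions are those that [is_derive_RInt_family] asks of an integrand. *)
Lemma dterm_correct (b : R -> C -> R) (v w : R -> R) (e s : R) :
  class_C 1 b -> (forall r, continuous v r) -> (forall r, continuous w r) ->
  energy e 1 <> 0 ->
  is_derive (fun r => term b v w r s) e (dterm b v w e s) /\
  continuous (fun p : R * R => dterm b v w (fst p) (snd p)) (e, s) /\
  continuous (term b v w e) s.
Proof.
  intros Hb Hv Hw He.
  destruct (class_C1_partials b Hb) as (_ & _ & _ & Cb & Ct & Cx & Cy).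
  split; [|split].
  - apply (is_derive_Rmult (fun r => b (T r s) (X r s, Y r s)) (fun r => v s + r * w s) e
             (d_t b (T e s) (X e s, Y e s) * dT e s + d_x b (T e s) (X e s, Y e s) * Re (xi s)
              + d_y b (T e s) (X e s, Y e s) * Im (xi s)) (w s)).
    + apply (class_C1_chain b (fun r => T r s) (fun r => X r s) (fun r => Y r s)); [easy| | |].
      * unfold T. unfold dT. apply (is_derive_div (fun r => energy r s) (fun r => energy r 1)); [| |easy]; unfold energy, denergy;
          auto_derive; try easy; ring.
      * unfold X. auto_derive; [easy|ring].
      * unfold Y. auto_derive; [easy|ring].
    + auto_derive; [easy|ring].
  - assert (KT : continuous (fun p : R * R => T (fst p) (snd p)) (e, s)).
    { unfold T. cont; [| |easy]; unfold energy; cont2. }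
    assert (KdT : continuous (fun p : R * R => dT (fst p) (snd p)) (e, s)).
    { unfold dT. cont; [| | | | |now apply pow_nonzero]; unfold energy, denergy; cont2. }
    assert (KX : continuous (fun p : R * R => X (fst p) (snd p)) (e, s)).
    { unfold X. cont2. }
    assert (KY : continuous (fun p : R * R => Y (fst p) (snd p)) (e, s)).
    { unfold Y. cont2. }
    unfold dterm. cont; try assumption; try (now apply class_C0_continuous); cont2.
  - assert (KT : continuous (T e) s).
    { unfold T. cont; [|easy]. unfold energy.
      cont; auto using continuous_partial_inner; apply continuous_const. }
    unfold term. cont; auto; try apply continuous_const.
    apply class_C0_continuous; [easy|easy| |]; [unfold X|unfold Y]; cont;
      try apply continuous_const; try apply z_cont; apply xi_cont.
Qed.

Let dx (u : R -> C) (s : R) : R := Re (vderiv u s).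
Let dy (u : R -> C) (s : R) : R := Im (vderiv u s).

Let variation (e s : R) : R :=
  dterm (a1 theta) (dx z) (dx xi) e s + dterm (a2 theta) (dy z) (dy xi) e s.

(** No restriction on e is needed: if the shifted loop vanishes, both sides divide by the same
    zero. *)
Lemma magnetic_shift (e : R) :
  magnetic theta (shift z xi e)
  = RInt (fun s => term (a1 theta) (dx z) (dx xi) e s + term (a2 theta) (dy z) (dy xi) e s) 0 1.
Proof.
  apply RInt_ext. intros s _.
  rewrite (vartheta_coords theta theta_smooth), time_eq by now apply loop_shift.
  rewrite vderiv_shift by easy. rewrite !partial_inner_shift by easy.
  unfold term. fold (energy e s) (energy e 1). fold (T e s).
  replace (shift z xi e s) with ((X e s, Y e s) : C).
  2: { unfold X, Y, shift. apply injective_projections; unfold Re, Im; simpl; ring. }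
  unfold dx, dy, shift. f_equal; f_equal; unfold Re, Im; simpl; ring.
Qed.

Lemma is_derive_magnetic_shift :
  is_derive (fun e => magnetic theta (shift z xi e)) 0 (RInt (variation 0) 0 1).
Proof.
  apply (is_derive_ext (fun e => RInt (fun s => term (a1 theta) (dx z) (dx xi) e s
                                              + term (a2 theta) (dy z) (dy xi) e s) 0 1)).
  { intros e. symmetry. apply magnetic_shift. }
  apply (is_derive_RInt_family
    (fun e s => term (a1 theta) (dx z) (dx xi) e s + term (a2 theta) (dy z) (dy xi) e s)).
  pose proof (continuous_curve_vderiv z z_loop) as Kz.
  pose proof (continuous_curve_vderiv xi xi_loop) as Kxi.
  apply (filter_imp _ _) with (2 := energy_pos_near). intros e He s.
  destruct (dterm_correct (a1 theta) (dx z) (dx xi) e s) as (H1 & H2 & H3);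
    [now apply class_C1_a1|apply Kz|apply Kxi|lra|].
  destruct (dterm_correct (a2 theta) (dy z) (dy xi) e s) as (G1 & G2 & G3);
    [now apply class_C1_a2|apply Kz|apply Kxi|lra|].
  split; [|split].
  - now apply (is_derive_plus (V := R_NormedModule)).
  - unfold variation. now apply continuous_Rplus.
  - now apply continuous_Rplus.
Qed.

Lemma continuous_variation (s : R) : continuous (variation 0) s.
Proof.
  pose proof (continuous_curve_vderiv z z_loop) as Kz.
  pose proof (continuous_curve_vderiv xi xi_loop) as Kxi.
  assert (He : energy 0 1 <> 0).
  { unfold energy. pose proof (partial_inner_pos z z_nonzero). nra. }
  assert (H : continuous (fun p : R * R => variation (fst p) (snd p)) (0, s)).
  { unfold variation. apply continuous_Rplus.
    - exact (proj1 (proj2 (dterm_correct (a1 theta) (dx z) (dx xi) 0 s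
        (class_C1_a1 theta theta_smooth) (fun r => proj1 (Kz r)) (fun r => proj1 (Kxi r)) He))).
    - exact (proj1 (proj2 (dterm_correct (a2 theta) (dy z) (dy xi) 0 s
        (class_C1_a2 theta theta_smooth) (fun r => proj2 (Kz r)) (fun r => proj2 (Kxi r)) He))). }
  apply (continuous_comp (fun r => (0, r)) (fun p : R * R => variation (fst p) (snd p)) s);
    [|easy].
  apply continuous_pair; [apply continuous_const|apply continuous_id].
Qed.

Let A : R := partial_inner z z 1.
Let B : R := partial_inner z xi 1.

Lemma A_neq_0 : A <> 0.
Proof. pose proof (partial_inner_pos z z_nonzero). unfold A. lra. Qed.

Lemma variation_0 (s : R) :
  variation 0 s =
  a_dot_speed theta z s
    * ((2 * partial_inner z xi s * A - partial_inner z z s * (2 * B)) / A ^ 2)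
  + (d_x (a1 theta) (time z s) (z s) * Re (xi s)
     + d_y (a1 theta) (time z s) (z s) * Im (xi s)) * Re (vderiv z s)
  + (d_x (a2 theta) (time z s) (z s) * Re (xi s)
     + d_y (a2 theta) (time z s) (z s) * Im (xi s)) * Im (vderiv z s)
  + (a1 theta (time z s) (z s) * Re (vderiv xi s)
     + a2 theta (time z s) (z s) * Im (vderiv xi s)).
Proof.
  assert (ET : T 0 s = time z s).
  { rewrite time_eq by easy. unfold T, energy. f_equal; ring. }
  assert (EdT : dT 0 s =
    (2 * partial_inner z xi s * A - partial_inner z z s * (2 * B)) / A ^ 2).
  { unfold dT, energy, denergy. fold A B. unfold Rdiv. f_equal; [|f_equal]; ring. }
  assert (EXY : ((X 0 s, Y 0 s) : C) = z s).
  { unfold X, Y. apply injective_projections; simpl; unfold Re, Im; ring. }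
  unfold variation, dterm. rewrite EXY, ET, EdT.
  unfold a_dot_speed, a_dot_along, a_dot, dx, dy.
  generalize ((2 * partial_inner z xi s * A - partial_inner z z s * (2 * B)) / A ^ 2).
  intros k. unfold dot. simpl. ring.
Qed.

(* The boundary terms left by the two integrations by parts which move the
   derivative of [xi] and the primitive of [<z, xi>] off the test loop. *)
Let boundary (s : R) : R :=
  a1 theta (time z s) (z s) * Re (xi s) + a2 theta (time z s) (z s) * Im (xi s)
  + (- (2 / A)) * (RInt (a_dot_speed theta z) s 1 * partial_inner z xi s)
  + (- (2 * B / A ^ 2)) * weighted_speed theta z s
  + 2 * weighted_speed theta z 1 / A ^ 2 * partial_inner z xi s.

(** The variation differentiates the coefficients along xi and pairs them with z'; differentiating
    them along z and pairing with xi does the opposite. The spatial parts differ by [rot_a] times a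
    determinant, and the time part is the term in |z|^2 [a_dot]. The product rule for the third
    summand trades the primitive of <z, xi> for the integral from s to 1, and the last two summands
    do the same for the change of the total energy. *)
Lemma is_derive_boundary (s : R) :
  is_derive boundary s (variation 0 s - dot (grad_formula theta z s) (xi s)).
Proof.
  rewrite variation_0, dot_grad_formula by easy. fold A.
  destruct (loop_smooth xi xi_loop) as [Hp Hq].
  pose proof (is_derive_Rmult _ _ s _ _
    (is_derive_along z z_nonzero (a1 theta) s (class_C1_a1 theta theta_smooth))
    (smooth_is_derive _ s Hp)) as H1.
  pose proof (is_derive_Rmult _ _ s _ _
    (is_derive_along z z_nonzero (a2 theta) s (class_C1_a2 theta theta_smooth))
    (smooth_is_derive _ s Hq)) as H2.
  pose proof (is_derive_partial_inner z xi s z_cont xi_cont) as HP.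
  pose proof (is_derive_Rmult _ _ s _ _
    (is_derive_RInt_lower (a_dot_speed theta z) 1 s
       (continuous_a_dot_speed theta theta_smooth z z_nonzero)) HP) as H3.
  pose proof (is_derive_weighted_speed theta theta_smooth z z_nonzero s) as H4.
  pose proof (is_derive_plus (V := R_NormedModule) _ _ s _ _
    (is_derive_plus (V := R_NormedModule) _ _ s _ _
      (is_derive_plus (V := R_NormedModule) _ _ s _ _
        (is_derive_plus (V := R_NormedModule) _ _ s _ _ H1 H2)
        (is_derive_scal _ s (- (2 / A)) _ H3))
      (is_derive_scal _ s (- (2 * B / A ^ 2)) _ H4))
    (is_derive_scal _ s (2 * weighted_speed theta z 1 / A ^ 2) _ HP)) as H.
  match type of H with is_derive _ _ ?l => replace (_ - _) with l; [exact H|] end.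
  unfold plus; simpl.
  generalize (RInt (a_dot_speed theta z) s 1) (weighted_speed theta z 1). intros I2 I1.
  unfold a_dot_speed, rot_a, a_dot_along, a_dot.
  unfold dot, vderiv, Re, Im; simpl. fold A. field. apply A_neq_0.
Qed.

Hypothesis theta_periodic : forall (t : R) (w v : C), theta (t + 1) w v = theta t w v.

(** Time runs from 0 to 1 while z and xi close up, so periodicity of the form matches the first two
    summands. The third vanishes at both ends, at 0 through the inner product and at 1 through the
    empty integral. The last two vanish at 0 and cancel at 1, each being 2 B [weighted_speed] 1 /
    A^2 up to sign. *)
Lemma boundary_periodic : boundary 1 = boundary 0.
Proof.
  assert (E0 : partial_inner z xi 0 = 0).
  { exact (RInt_point (V := R_CompleteNormedModule) 0 (fun r => dot (z r) (xi r))). }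
  assert (K0 : weighted_speed theta z 0 = 0).
  { exact (RInt_point (V := R_CompleteNormedModule) 0
      (fun r => partial_inner z z r * a_dot_speed theta z r)). }
  assert (I0 : RInt (a_dot_speed theta z) 1 1 = 0).
  { exact (RInt_point (V := R_CompleteNormedModule) 1 (a_dot_speed theta z)). }
  assert (T1 : time z 1 = 0 + 1).
  { rewrite time_eq by easy. fold A. field. apply A_neq_0. }
  assert (T0 : time z 0 = 0).
  { rewrite time_eq by easy.
    replace (partial_inner z z 0) with 0; [apply Rdiv_0_l|]. symmetry.
    exact (RInt_point (V := R_CompleteNormedModule) 0 (fun r => dot (z r) (z r))). }
  assert (Z1 : z 1 = z 0) by (rewrite <- (proj1 z_loop 0); f_equal; ring).
  assert (X1 : xi 1 = xi 0) by (rewrite <- (proj1 xi_loop 0); f_equal; ring).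
  unfold boundary. rewrite E0, K0, I0, T1, T0, Z1, X1. fold B.
  unfold a1, a2, vartheta, pullback. rewrite !theta_periodic. field. apply A_neq_0.
Qed.

Lemma RInt_variation : RInt (variation 0) 0 1 = L2inner (grad_formula theta z) xi.
Proof.
  pose proof (continuous_dot_grad_formula theta theta_smooth z z_nonzero xi) as Kg.
  assert (H : is_RInt (fun s => variation 0 s - dot (grad_formula theta z s) (xi s)) 0 1
                (boundary 1 - boundary 0)).
  { apply (is_RInt_derive (V := R_CompleteNormedModule) boundary).
    - intros s _. apply is_derive_boundary.
    - intros s _. apply continuous_Rminus; [apply continuous_variation|now apply Kg]. }
  rewrite boundary_periodic in H.
  pose proof (is_RInt_minus (V := R_NormedModule) _ _ 0 1 _ _
    (RInt_correct (V := R_CompleteNormedModule) _ 0 1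
       (ex_RInt_cont _ 0 1 continuous_variation))
    (RInt_correct (V := R_CompleteNormedModule) _ 0 1
       (ex_RInt_cont _ 0 1 (fun s => Kg s xi_cont)))) as H'.
  apply (is_RInt_unique (V := R_CompleteNormedModule)) in H.
  apply (is_RInt_unique (V := R_CompleteNormedModule)) in H'.
  unfold minus, plus, opp in H'; simpl in H'. unfold Rminus in H. rewrite H' in H.
  unfold L2inner. lra.
Qed.

Lemma is_derive_magnetic :
  is_derive (fun e => magnetic theta (shift z xi e)) 0 (L2inner (grad_formula theta z) xi).
Proof. rewrite <- RInt_variation. apply is_derive_magnetic_shift. Qed.

End Variation.

(** * Gradient and critical points *)

Lemma partial_inner_sym (u v : R -> C) (s : R) : partial_inner u v s = partial_inner v u s.
Proof. apply RInt_ext. intros r _. unfold dot. simpl. ring. Qed.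

Lemma partial_inner_shift_l (u v w : R -> C) (e s : R) :
  continuous_curve u -> continuous_curve v -> continuous_curve w ->
  partial_inner (shift u v e) w s = partial_inner u w s + e * partial_inner v w s.
Proof.
  intros Hu Hv Hw.
  transitivity (partial_inner u w s + e * partial_inner v w s + 0 * partial_inner u w s);
    [|ring].
  unfold partial_inner. rewrite <- RInt_lin3 by (intros; now apply continuous_dot).
  apply RInt_ext. intros r _. unfold dot, shift, Re, Im. simpl. ring.
Qed.

Lemma continuous_curve_shift (u v : R -> C) (e : R) :
  continuous_curve u -> continuous_curve v -> continuous_curve (shift u v e).
Proof.
  intros Hu Hv s. split.
  - apply (continuous_ext (fun r => Re (u r) + e * Re (v r))).
    { intros r. unfold shift. simpl. unfold Re, Im. now rewrite Rmult_0_l, Rminus_0_r. }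
    cont; [apply Hu|apply Hv].
  - apply (continuous_ext (fun r => Im (u r) + e * Im (v r))).
    { intros r. unfold shift. simpl. unfold Re, Im. now rewrite Rmult_0_l, Rplus_0_r. }
    cont; [apply Hu|apply Hv].
Qed.

Lemma orthogonal_loops_zero_C (h : R -> C) (s : R) :
  continuous_on unit_interval (fun r => Re (h r)) ->
  continuous_on unit_interval (fun r => Im (h r)) ->
  (forall xi, loop xi -> is_RInt (fun r => dot (h r) (xi r)) 0 1 0) ->
  0 <= s < 1 -> h s = RtoC 0.
Proof.
  intros H1 H2 Hint Hs. apply injective_projections.
  - apply (orthogonal_loops_zero (fun r => Re (h r)) s H1); [|easy].
    intros phi Hphi. apply (is_RInt_ext (fun r => dot (h r) (phi r, 0))).
    + intros r _. unfold dot. simpl. ring.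
    + apply Hint, loop_Re_Im. split; [exact Hphi|exact (real_loop_const 0)].
  - apply (orthogonal_loops_zero (fun r => Im (h r)) s H2); [|easy].
    intros phi Hphi. apply (is_RInt_ext (fun r => dot (h r) (0, phi r))).
    + intros r _. unfold dot. simpl. ring.
    + apply Hint, loop_Re_Im. split; [exact (real_loop_const 0)|exact Hphi].
Qed.

Lemma orthogonal_loops_zero_curve (h : R -> C) (s : R) :
  continuous_curve h -> (forall xi, loop xi -> partial_inner h xi 1 = 0) ->
  0 <= s < 1 -> h s = RtoC 0.
Proof.
  intros Hh Hint. apply orthogonal_loops_zero_C.
  - apply continuous_continuous_on. apply Hh.
  - apply continuous_continuous_on. apply Hh.
  - intros xi Hxi.
    pose proof (RInt_correct (V := R_CompleteNormedModule) (fun r => dot (h r) (xi r)) 0 1) as H.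
    change (RInt (fun r => dot (h r) (xi r)) 0 1) with (partial_inner h xi 1) in H.
    rewrite (Hint xi Hxi) in H. apply H, ex_RInt_cont.
    intros r. apply continuous_dot; [easy|]. now apply continuous_curve_loop.
Qed.

Lemma continuous_on_Rminus (D : R -> Prop) (f g : R -> R) :
  continuous_on D f -> (forall s, continuous g s) -> continuous_on D (fun s => f s - g s).
Proof.
  intros Hf Hg s Hs.
  apply (filterlim_comp_2 (F := within D (locally s)) (G := locally (f s))
           (H := locally (- g s)) f (fun r => - g r) Rplus).
  - now apply Hf.
  - apply (continuous_continuous_on D (fun r => - g r)); [|easy]. intros r.
    now apply continuous_Ropp.
  - apply (filterlim_plus (V := R_NormedModule)).
Qed.

Lemma continuous_on_Re_Im (D : R -> Prop) (w : R -> C_R_NormedModule) :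
  continuous_on D w ->
  continuous_on D (fun s => Re (w s)) /\ continuous_on D (fun s => Im (w s)).
Proof.
  intros Hw. split; intros s Hs.
  - apply (filterlim_comp _ _ _ w Re _ _ _ (Hw s Hs)).
    destruct (w s). apply (continuous_fst (U := R_UniformSpace) (V := R_UniformSpace)).
  - apply (filterlim_comp _ _ _ w Im _ _ _ (Hw s Hs)).
    destruct (w s). apply (continuous_snd (U := R_UniformSpace) (V := R_UniformSpace)).
Qed.

Lemma continuous_curve_continuous (w : R -> C) (s : R) :
  continuous_curve w -> continuous (w : R -> C_R_NormedModule) s.
Proof.
  intros Hw.
  apply (continuous_ext (fun r => ((Re (w r), Im (w r)) : C_R_NormedModule))).
  { intros r. unfold Re, Im. now rewrite <- surjective_pairing. }
  exact (continuous_pair (fun r => Re (w r)) (fun r => Im (w r)) s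
           (proj1 (Hw s)) (proj2 (Hw s))).
Qed.

Lemma vderiv_periodic (z : R -> C) (s : R) : loop z -> vderiv z (s + 1) = vderiv z s.
Proof.
  intros Hz. pose proof (loop_smooth z Hz) as [Hx Hy]. destruct Hz as [Hp _].
  assert (H : forall f : R -> R, smooth f -> (forall r, f (r + 1) = f r) ->
                Derive f (s + 1) = Derive f s).
  { intros f Hf Hpf. symmetry. apply is_derive_unique.
    apply (is_derive_ext (fun r => f (r + 1)) _ _ _ Hpf).
    rewrite <- (Rmult_1_l (Derive f (s + 1))).
    apply (is_derive_comp f (fun r => r + 1)); [now apply smooth_is_derive|].
    auto_derive; [easy|ring]. }
  apply injective_projections; simpl; apply H; try easy; intros r; now rewrite Hp.
Qed.

Lemma partial_inner_vderiv (u v : R -> C) :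
  loop u -> loop v -> partial_inner u (vderiv v) 1 = - partial_inner (vderiv u) v 1.
Proof.
  intros Hu Hv.
  pose proof (continuous_curve_loop u Hu) as Ku. pose proof (continuous_curve_loop v Hv) as Kv.
  pose proof (continuous_curve_vderiv u Hu) as Kdu.
  pose proof (continuous_curve_vderiv v Hv) as Kdv.
  destruct (loop_smooth u Hu) as [Su1 Su2]. destruct (loop_smooth v Hv) as [Sv1 Sv2].
  assert (H : is_RInt (fun s => dot (vderiv u s) (v s) + dot (u s) (vderiv v s)) 0 1
                (dot (u 1) (v 1) - dot (u 0) (v 0))).
  { apply (is_RInt_derive (V := R_CompleteNormedModule) (fun s => dot (u s) (v s))).
    - intros s _.
      pose proof (is_derive_plus (V := R_NormedModule) _ _ s _ _
        (is_derive_Rmult _ _ s _ _ (smooth_is_derive _ s Su1) (smooth_is_derive _ s Sv1))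
        (is_derive_Rmult _ _ s _ _ (smooth_is_derive _ s Su2) (smooth_is_derive _ s Sv2))) as H.
      match type of H with is_derive _ _ ?l => replace (_ + _) with l; [exact H|] end.
      unfold plus, dot, vderiv. simpl. unfold Re, Im. simpl. ring.
    - intros s _. apply continuous_Rplus; now apply continuous_dot. }
  replace (u 1) with (u 0) in H by (rewrite <- (proj1 Hu 0); f_equal; ring).
  replace (v 1) with (v 0) in H by (rewrite <- (proj1 Hv 0); f_equal; ring).
  pose proof (is_RInt_plus (V := R_NormedModule) _ _ 0 1 _ _
    (RInt_correct (V := R_CompleteNormedModule) _ 0 1
       (ex_RInt_cont _ 0 1 (fun s => continuous_dot _ _ s Kdu Kv)))
    (RInt_correct (V := R_CompleteNormedModule) _ 0 1
       (ex_RInt_cont _ 0 1 (fun s => continuous_dot _ _ s Ku Kdv)))) as H'.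
  apply (is_RInt_unique (V := R_CompleteNormedModule)) in H.
  apply (is_RInt_unique (V := R_CompleteNormedModule)) in H'.
  unfold plus in H'; simpl in H'. rewrite H' in H.
  unfold partial_inner. lra.
Qed.

(** * Existence and uniqueness of the gradient, and the differential of the action *)

Section MagneticGradient.

Variable theta : R -> C -> C -> R.
Hypothesis theta_smooth : smooth_form_family theta.
Hypothesis theta_periodic : forall (t : R) (w xi : C), theta (t + 1) w xi = theta t w xi.
Variable z : R -> C.
Hypothesis z_nonzero : nonzero_loop z.

(* [grad_formula] itself is not periodic: it jumps by a multiple of [z] over one period. *)
Definition grad_magnetic (tau : R) : C := grad_formula theta z (frac_part tau).

Lemma dot_grad_magnetic (xi : R -> C) (s : R) :
  0 < s < 1 -> dot (grad_magnetic s) (xi s) = dot (grad_formula theta z s) (xi s).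
Proof. intros Hs. unfold grad_magnetic. rewrite frac_part_id; [easy|lra]. Qed.

Lemma grad_magnetic_is_gradient : is_L2_gradient (magnetic theta) z grad_magnetic.
Proof.
  pose proof (continuous_curve_grad_formula theta theta_smooth z z_nonzero) as Kg.
  split; [|split].
  - intros s. unfold grad_magnetic. now rewrite frac_part_add1.
  - apply (continuous_on_ext _ (grad_formula theta z : R -> C_R_NormedModule)).
    { intros s Hs. unfold grad_magnetic. now rewrite frac_part_id. }
    apply (continuous_continuous_on (U := C_R_NormedModule)). intros s.
    now apply continuous_curve_continuous.
  - intros xi Hxi. split.
    + apply (ex_RInt_ext (fun s => dot (grad_formula theta z s) (xi s))).
      { rewrite Rmin_left, Rmax_right by lra. intros s Hs. symmetry.
        now apply dot_grad_magnetic. }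
      apply ex_RInt_cont. intros s. apply continuous_dot; [easy|].
      now apply continuous_curve_loop.
    + replace (L2inner grad_magnetic xi) with (L2inner (grad_formula theta z) xi).
      { now apply is_derive_magnetic. }
      symmetry. apply RInt_ext. rewrite Rmin_left, Rmax_right by lra.
      apply dot_grad_magnetic.
Qed.

Lemma gradient_unique (g : R -> C) (s : R) :
  is_L2_gradient (magnetic theta) z g -> 0 <= s < 1 -> g s = grad_formula theta z s.
Proof.
  intros (_ & Kg & Hg) Hs.
  pose proof (continuous_curve_grad_formula theta theta_smooth z z_nonzero) as Kf.
  assert (Hz : (g s - grad_formula theta z s)%C = RtoC 0).
  { apply (orthogonal_loops_zero_C (fun r => g r - grad_formula theta z r)%C); [| | |easy].
    - apply (continuous_on_ext _ (fun r => Re (g r) - Re (grad_formula theta z r))).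
      { intros r _. reflexivity. }
      apply continuous_on_Rminus; [now apply continuous_on_Re_Im|apply Kf].
    - apply (continuous_on_ext _ (fun r => Im (g r) - Im (grad_formula theta z r))).
      { intros r _. reflexivity. }
      apply continuous_on_Rminus; [now apply continuous_on_Re_Im|apply Kf].
    - intros xi Hxi. destruct (Hg xi Hxi) as [Hex Hder].
      pose proof (is_derive_magnetic theta theta_smooth z xi z_nonzero Hxi theta_periodic) as Hf.
      apply is_derive_unique in Hder. apply is_derive_unique in Hf. rewrite Hder in Hf.
      pose proof (is_RInt_minus (V := R_NormedModule) _ _ 0 1 _ _
        (RInt_correct (V := R_CompleteNormedModule) _ 0 1 Hex)
        (RInt_correct (V := R_CompleteNormedModule) _ 0 1
          (ex_RInt_cont _ 0 1 (fun s =>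
             continuous_dot _ _ s Kf (continuous_curve_loop xi Hxi))))) as H.
      fold (L2inner g xi) in H. fold (L2inner (grad_formula theta z) xi) in H.
      rewrite Hf in H.
      replace (minus _ _) with 0 in H by (symmetry; apply Rminus_diag).
      revert H. apply is_RInt_ext. intros r _.
      unfold minus, plus, opp, dot, Re, Im; simpl. ring. }
  replace (g s) with ((g s - grad_formula theta z s) + grad_formula theta z s)%C by ring.
  rewrite Hz. ring.
Qed.

(** Apart from [magnetic], the action along a line is an explicit rational function of e. The
    coefficient with -8 merges the z-derivatives of the two terms in 1/|z|^2: 2 times (|eta|^2/8 -
    1)/|z|^4, with L2 norms. *)
Lemma is_derive_action (eta zhat etahat : R -> C) :
  loop eta -> loop zhat -> loop etahat ->
  is_derive (fun e => action theta (shift z zhat e) (shift eta etahat e)) 0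
    (partial_inner etahat (vderiv z) 1 + partial_inner eta (vderiv zhat) 1
     + partial_inner (grad_formula theta z) zhat 1
     - partial_inner eta etahat 1 / (4 * partial_inner z z 1)
     + (partial_inner eta eta 1 - 8) / (4 * partial_inner z z 1 ^ 2) * partial_inner z zhat 1).
Proof.
  intros Heta Hzhat Hetahat. pose proof (proj1 z_nonzero) as Hz.
  pose proof (partial_inner_pos z z_nonzero) as HA.
  pose proof continuous_curve_loop as K. pose proof continuous_curve_vderiv as K'.
  apply (is_derive_ext (fun e =>
    (partial_inner eta (vderiv z) 1
     + e * (partial_inner etahat (vderiv z) 1 + partial_inner eta (vderiv zhat) 1)
     + e ^ 2 * partial_inner etahat (vderiv zhat) 1
     - (partial_inner eta eta 1 + 2 * e * partial_inner eta etahat 1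
        + e ^ 2 * partial_inner etahat etahat 1)
       / (8 * (partial_inner z z 1 + 2 * e * partial_inner z zhat 1
               + e ^ 2 * partial_inner zhat zhat 1))
     + 1 / (partial_inner z z 1 + 2 * e * partial_inner z zhat 1
            + e ^ 2 * partial_inner zhat zhat 1))
    + magnetic theta (shift z zhat e))).
  { intros e. unfold action. rewrite !L2norm_sq by now apply loop_shift.
    rewrite !partial_inner_shift by auto.
    fold (magnetic theta (shift z zhat e)).
    change (L2inner ?u ?v) with (partial_inner u v 1).
    replace (vderiv (shift z zhat e)) with (shift (vderiv z) (vderiv zhat) e).
    2: { apply functional_extensionality. intros s. symmetry. now apply vderiv_shift. }
    rewrite partial_inner_shift_l by auto using continuous_curve_shift.
    (* Linearity is available in the left slot only, so the shifted derivative is moved there,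
       expanded, and moved back. *)
    rewrite (partial_inner_sym eta (shift _ _ _)), (partial_inner_sym etahat (shift _ _ _)).
    rewrite !partial_inner_shift_l by auto.
    rewrite (partial_inner_sym (vderiv z)), (partial_inner_sym (vderiv zhat)),
      (partial_inner_sym (vderiv z)), (partial_inner_sym (vderiv zhat)).
    match goal with |- ?l = ?r => change (@eq R l r) end. ring. }
  evar_last.
  - apply (is_derive_plus (V := R_NormedModule)).
    + auto_derive; [|reflexivity]. nra.
    + now apply is_derive_magnetic.
  - unfold plus; simpl. change (L2inner ?u ?v) with (partial_inner u v 1).
    set (A := partial_inner z z 1) in *. field. lra.
Qed.

End MagneticGradient.

(** * The Euler-Lagrange equations *)

Lemma loop_zero : loop (fun _ => RtoC 0).
Proof. apply loop_Re_Im. split; exact (real_loop_const 0). Qed.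

Lemma partial_inner_zero_l (u : R -> C) (s : R) : partial_inner (fun _ => RtoC 0) u s = 0.
Proof.
  unfold partial_inner.
  rewrite (RInt_ext _ (fun _ => 0)) by (intros; unfold dot; simpl; ring).
  rewrite RInt_const. apply Rmult_0_r.
Qed.

Lemma partial_inner_zero_r (u : R -> C) (s : R) : partial_inner u (fun _ => RtoC 0) s = 0.
Proof. rewrite partial_inner_sym. apply partial_inner_zero_l. Qed.

Lemma vderiv_zero : vderiv (fun _ => RtoC 0) = (fun _ => RtoC 0).
Proof.
  apply functional_extensionality. intros s.
  apply injective_projections; simpl; apply Derive_const.
Qed.

Section CriticalPoints.

Variable theta : R -> C -> C -> R.
Hypothesis theta_smooth : smooth_form_family theta.
Hypothesis theta_periodic : forall (t : R) (w xi : C), theta (t + 1) w xi = theta t w xi.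
Variables z eta : R -> C.
Hypothesis z_nonzero : nonzero_loop z.
Hypothesis eta_loop : loop eta.
Hypothesis critical : critical_point (action theta) z eta.

Let A : R := partial_inner z z 1.

Lemma critical_vanishing (zhat etahat : R -> C) :
  loop zhat -> loop etahat ->
  partial_inner etahat (vderiv z) 1 + partial_inner eta (vderiv zhat) 1
  + partial_inner (grad_formula theta z) zhat 1
  - partial_inner eta etahat 1 / (4 * A)
  + (partial_inner eta eta 1 - 8) / (4 * A ^ 2) * partial_inner z zhat 1 = 0.
Proof.
  intros Hzh Heh.
  pose proof (is_derive_action theta theta_smooth theta_periodic z z_nonzero
    eta zhat etahat eta_loop Hzh Heh) as H1.
  apply is_derive_unique in H1. etransitivity; [symmetry; exact H1|].
  now apply is_derive_unique, critical.
Qed.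

Lemma critical_vderiv_z (s : R) : vderiv z s = (RtoC (1 / (4 * A)) * eta s)%C.
Proof.
  pose proof (proj1 z_nonzero) as Hz.
  pose proof continuous_curve_loop as K. pose proof continuous_curve_vderiv as K'.
  assert (HA : 0 < A) by now apply partial_inner_pos.
  (* The equation is written as the vanishing of a [shift], so that linearity of the inner product
     applies; varying eta alone makes this curve orthogonal to every loop. *)
  assert (H0 : forall r, 0 <= r < 1 -> shift (vderiv z) eta (- (1 / (4 * A))) r = RtoC 0).
  { intros r. apply orthogonal_loops_zero_curve; [apply continuous_curve_shift; auto|].
    intros xi Hxi. rewrite partial_inner_shift_l by auto.
    pose proof (critical_vanishing (fun _ => RtoC 0) xi loop_zero Hxi) as H.
    rewrite vderiv_zero, !partial_inner_zero_r, (partial_inner_sym xi) in H.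
    unfold Rdiv in *. lra. }
  specialize (H0 (frac_part s) (frac_part_unit s)). unfold shift in H0.
  rewrite (periodic_frac_part (vderiv z)) in H0 by (intros; now apply vderiv_periodic).
  rewrite (periodic_frac_part eta s (proj1 eta_loop)) in H0.
  rewrite RtoC_opp in H0.
  replace (vderiv z s) with
    ((vderiv z s + - RtoC (1 / (4 * A)) * eta s) + RtoC (1 / (4 * A)) * eta s)%C by ring.
  rewrite H0. ring.
Qed.

Lemma critical_vderiv_eta (s : R) :
  vderiv eta s = (RtoC ((partial_inner eta eta 1 - 8) / (4 * A ^ 2)) * z s
                  + grad_magnetic theta z s)%C.
Proof.
  pose proof (proj1 z_nonzero) as Hz.
  pose proof continuous_curve_loop as K. pose proof continuous_curve_vderiv as K'.
  pose proof (continuous_curve_grad_formula theta theta_smooth z z_nonzero) as Kg.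
  set (c := (partial_inner eta eta 1 - 8) / (4 * A ^ 2)).
  (* The double shift is eta' - c z - [grad_formula]. Varying z alone and moving the derivative from
     the test loop to eta makes it orthogonal to every loop. *)
  assert (H0 : forall r, 0 <= r < 1 ->
    shift (shift (vderiv eta) z (- c)) (grad_formula theta z) (- (1)) r = RtoC 0).
  { intros r. apply orthogonal_loops_zero_curve; [auto using continuous_curve_shift|].
    intros xi Hxi.
    rewrite partial_inner_shift_l by auto using continuous_curve_shift.
    rewrite partial_inner_shift_l by auto.
    pose proof (critical_vanishing xi (fun _ => RtoC 0) Hxi loop_zero) as H.
    rewrite partial_inner_zero_l, partial_inner_zero_r, partial_inner_vderiv in H by easy.
    fold c in H. unfold Rdiv in H. lra. }
  specialize (H0 (frac_part s) (frac_part_unit s)). unfold shift in H0.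
  rewrite (periodic_frac_part (vderiv eta)) in H0 by (intros; now apply vderiv_periodic).
  rewrite (periodic_frac_part z s (proj1 Hz)) in H0.
  (* Evaluated at the fractional part, [grad_formula] is [grad_magnetic] by definition; so the
     equation at every time involves the periodised gradient. *)
  rewrite !RtoC_opp in H0. fold (grad_magnetic theta z s) in H0.
  replace (vderiv eta s) with
    ((vderiv eta s + - RtoC c * z s + - RtoC 1 * grad_magnetic theta z s)
     + (RtoC c * z s + grad_magnetic theta z s))%C by ring.
  rewrite H0. ring.
Qed.

End CriticalPoints.

Theorem theorem3
  (theta : R -> C -> C -> R)
  (theta_smooth : smooth_form_family theta)
  (theta_periodic : forall (t : R) (w xi : C), theta (t + 1)%R w xi = theta t w xi) :
  (forall z eta : R -> C,
      nonzero_loop z -> loop eta -> critical_point (action theta) z eta ->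
      exists gradM : R -> C,
        is_L2_gradient (magnetic theta) z gradM /\
        forall tau : R,
          vderiv z tau = (RtoC (1 / (4 * L2norm z ^ 2))%R * eta tau)%C /\
          vderiv eta tau =
            (RtoC ((L2norm eta ^ 2 - 8) / (4 * L2norm z ^ 4))%R * z tau
             + gradM tau)%C)
  /\
  (forall z : R -> C,
      nonzero_loop z ->
      (exists gradM : R -> C, is_L2_gradient (magnetic theta) z gradM) /\
      (forall gradM : R -> C,
          is_L2_gradient (magnetic theta) z gradM ->
          forall tau : R, (0 <= tau < 1)%R -> gradM tau = grad_formula theta z tau)).
Proof.
  split.
  - intros z eta Hz Heta Hcrit. exists (grad_magnetic theta z). split.
    + now apply grad_magnetic_is_gradient.
    + intros tau. replace (L2norm z ^ 4) with ((L2norm z ^ 2) ^ 2) by ring.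
      rewrite (L2norm_sq z (proj1 Hz)), (L2norm_sq eta Heta). split.
      * now apply (critical_vderiv_z theta).
      * now apply critical_vderiv_eta.
  - intros z Hz. split.
    + exists (grad_magnetic theta z). now apply grad_magnetic_is_gradient.
    + intros g Hg tau Htau. now apply gradient_unique.
Qed.
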